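(* Let $k$ be an algebraically closed field, $W$ a $2n$-dimensional symplectic $k$-vector space, $K=\mathrm{Sp}(W)$, and let $(\mu;\nu)$ be a bipartition of $n$. Suppose $(w,y)\in\mathbb{O}_{\mu;\nu}$, and let $K^{(w,y)}$ be its stabiliser in $K$. Then $$K^{(w,y)}\cong U\rtimes\left(\left(\prod_{h\in J}\mathrm{Sp}_{2n_{l_h}-2}(k)\right)\times\left(\prod_{h\notin J}\mathrm{Sp}_{2n_{l_h}}(k)\right)\right)$$ where $U$ is unipotent and isomorphic (as a variety) to affine space of dimension $$n+2b(\mu;\nu)-\sum_{h\in J}\left[2(n_{l_h}-1)^2+(n_{l_h}-1)\right]-\sum_{h\notin J}(2n_{l_h}^2+n_{l_h}).$$
   Context: A partition is a non-increasing sequence $\lambda=(\lambda_1,\lambda_2,\dots)$ of natural numbers that is eventually $0$; $|\lambda|=\sum_i\lambda_i$, $l(\lambda)$ is the number of nonzero terms, and $n(\lambda)=\sum_{i\ge1}(i-1)\lambda_i$. A bipartition of $n$ is a pair of partitions $(\mu;\nu)$ such that $\mu+\nu$ (termwise sum) is a partition of $n$. Put $\lambda=\mu+\nu$ and $b(\mu;\nu)=|\nu|+2n(\mu)+2n(\nu)$. Let $l_1>l_2>\dots>l_s\geq 1$ be the distinct nonzero parts of $\lambda$, let $n_{l_h}>0$ be the multiplicity of $l_h$ in $\lambda$. The sequences $\mu_i$ and $\nu_i$ are constant on the set of $i$ with $\lambda_i=l_h$; call the constant values $j_h$ and $k_h$ respectively. Set $k_0=\infty$ and $j_{s+1}=0$,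 and $$J=\{h\in\{1,\dots,s\} : j_h>j_{h+1}\text{ and }k_h<k_{h-1}\}.$$ Products and sums over $h\notin J$ run over $h\in\{1,\dots,s\}\setminus J$. Enhanced cone: let $V$ be an $n$-dimensional $k$-vector space, $\mathcal{N}\subset\mathrm{End}(V)$ the set of nilpotent endomorphisms, and let $\mathrm{GL}(V)$ act on $V\times\mathcal{N}$ by $g(v,x)=(gv,gxg^{-1})$. A Jordan basis for $x\in\mathcal{N}$ of Jordan type $\lambda$ is a basis $\{v_{ij} : 1\le i\le l(\lambda),1\le j\le\lambda_i\}$ of $V$ with $xv_{ij}=v_{i,j-1}$ for $j>1$ and $xv_{i1}=0$. $\mathcal{O}_{\mu;\nu}$ is the $\mathrm{GL}(V)$-orbit consisting of those $(v,x)$ such that $x$ has Jordan type $\mu+\nu$ and admits a Jordan basis with $v=\sum_i v_{i\mu_i}$ (with $v_{i0}=0$). Exotic cone: write $W=V\oplus V^*$ with symplectic form $\langle(v,f),(v',f')\rangle=f'(v)-f(v')$. Let $\mathfrak{N}_0=\{y\in\mathrm{End}(W) : y\text{ nilpotent and }\langle yu,u\rangle=0\text{ for all }u\in W\}$. $K$ acts on the exotic nilpotent cone $W\times\mathfrak{N}_0$ by $g(w,y)=(gw,gyg^{-1})$. Embed $V\times\mathcal{N}$ in $W\times\mathfrak{N}_0$ by $(v,x)\mapsto((v,0),(x,x^t))$, where $x^t$ is the transpose acting on $V^*$. The $K$-orbits in $W\times\mathfrak{N}_0$ are in bijection with bipartitions of $n$ (Kato), $\mathbb{O}_{\mu;\nu}$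 being the unique $K$-orbit containing the image of $\mathcal{O}_{\mu;\nu}$. *)

(* Defs.v *)
From HB Require Import structures.
From mathcomp Require Import all_boot all_order all_algebra.
From mathcomp Require Export sesquilinear.
From mathcomp Require Export mpoly.

Set Implicit Arguments.
Unset Strict Implicit.
Unset Printing Implicit Defensive.

Import GRing.Theory.
Local Open Scope ring_scope.

(** Partitions and bipartitions.  A partition is the decreasing list of its
    nonzero parts: the part [lambda_{i+1}] is [nth 0 lam i], the number of
    parts is [size lam], and the sum of the parts is [sumn lam]. *)
Section Partitions.
Local Open Scope nat_scope.
Implicit Types lam mu nu : seq nat.

Definition is_partition lam : bool := sorted geq lam && (0 \notin lam).

Definition part_add mu nu : seq nat :=
  mkseq (fun i => nth 0 mu i + nth 0 nu i) (maxn (size mu) (size nu)).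

Definition is_bipartition (n : nat) mu nu : bool :=
  [&& is_partition mu, is_partition nu & sumn (part_add mu nu) == n].

(* The usual weight (i - 1) becomes i, as indices start at 0. *)
Definition npart lam : nat := \sum_(i < size lam) i * nth 0 lam i.

Definition bstat mu nu : nat := sumn nu + 2 * npart mu + 2 * npart nu.

(* [undup] keeps the decreasing order of the parts; block [h : 'I_s] here is
   block [h + 1] in the usual numbering 1, ..., s. *)
Definition dparts mu nu : seq nat := undup (part_add mu nu).

Definition mult mu nu (h : nat) : nat :=
  count_mem (nth 0 (dparts mu nu) h) (part_add mu nu).

(* Values of a row sequence [mu] (resp. [nu]) on the successive blocks of equal
   parts of [mu + nu]; it is constant on each block, so it is read off at the
   first row of the block. *)
Definition block_values mu nu (r : seq nat) : seq nat :=
  [seq nth 0 r (index l (part_add mu nu)) | l <- dparts mu nu].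

(* The default value of [nth] provides the convention that the mu-value past
   the last block is 0; the disjunct [h == 0] is the convention that the
   nu-value before the first block is infinite. *)
Definition Jset mu nu (h : nat) : bool :=
  let j := block_values mu nu mu in
  let k := block_values mu nu nu in
  (nth 0 j h.+1 < nth 0 j h) && ((h == 0) || (nth 0 k h < nth 0 k h.-1)).

Definition levi_rank mu nu (h : 'I_(size (dparts mu nu))) : nat :=
  if Jset mu nu h then (mult mu nu h).-1 else mult mu nu h.

Definition unipotent_dim (n : nat) mu nu : int :=
  (n%:Z + 2 * (bstat mu nu)%:Z
   - \sum_(h < size (dparts mu nu) | Jset mu nu h)
        (2 * ((mult mu nu h)%:Z - 1) ^+ 2 + ((mult mu nu h)%:Z - 1))
   - \sum_(h < size (dparts mu nu) | ~~ Jset mu nu h)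
        (2 * (mult mu nu h)%:Z ^+ 2 + (mult mu nu h)%:Z))%R.

End Partitions.

(** Affine varieties, as Zariski closed subsets of finite dimensional vector
    spaces.  Morphisms between them are the restrictions of polynomial maps. *)
Section Varieties.
Variable k : fieldType.

(* Independent of any choice of a basis of X. *)
Definition polyfun (X : vectType k) (f : X -> k) : Prop :=
  exists (m : nat) (l : 'I_m -> 'Hom(X, k^o)) (p : {mpoly k[m]}),
    forall x, f x = p.@[fun i => l i x].

Definition zariski_closed (X : vectType k) (A : X -> Prop) : Prop :=
  exists F : (X -> k) -> Prop,
    (forall f, F f -> polyfun f) /\
    (forall x, A x <-> forall f, F f -> f x = 0).

Definition morphism_of_varieties (X Y : vectType k)
    (A : X -> Prop) (B : Y -> Prop) (f : X -> Y) : Prop :=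
  (forall x, A x -> B (f x)) /\
  (forall l : 'Hom(Y, k^o),
     exists2 p : X -> k, polyfun p & forall x, A x -> l (f x) = p x).

Definition variety_isomorphism (X Y : vectType k)
    (A : X -> Prop) (B : Y -> Prop) (f : X -> Y) : Prop :=
  morphism_of_varieties A B f /\
  exists g : Y -> X, [/\ morphism_of_varieties B A g,
                         forall x, A x -> g (f x) = x &
                         forall y, B y -> f (g y) = y].

Definition isomorphic_varieties (X Y : vectType k)
    (A : X -> Prop) (B : Y -> Prop) : Prop :=
  exists f : X -> Y, variety_isomorphism A B f.

Definition affine_space (d : nat) (x : 'rV[k]_d) : Prop := True.

(* The multiplications are those of the ambient algebras. *)
Definition isomorphic_alg_groups (X Y : vectType k)
    (A : X -> Prop) (mulA : X -> X -> X)
    (B : Y -> Prop) (mulB : Y -> Y -> Y) : Prop :=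
  exists2 f : X -> Y, variety_isomorphism A B f
    & forall x y, A x -> A y -> f (mulA x y) = mulB (f x) (f y).

End Varieties.

(** Closed subgroups of GL(W), realised inside End(W). *)
Section LinearGroups.
Variables (k : fieldType) (W : vectType k).
Implicit Types G U L : 'End(W) -> Prop.

(* A subset of GL(W) that is closed in End(W); all the groups below preserve a
   symplectic form, hence are of this kind. *)
Definition closed_subgroup G : Prop :=
  [/\ zariski_closed G,
      G \1%VF,
      forall g h, G g -> G h -> G (g \o h)%VF &
      forall g, G g -> exists2 h, G h & (g \o h = \1)%VF /\ (h \o g = \1)%VF].

Definition unipotent G : Prop :=
  forall g, G g -> exists N : nat, forall a : W, iter N (fun b => g b - b) a = 0.

(* The last clause is what makes the abstract semidirect product a semidirect
   product of algebraic groups. *)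
Definition alg_semidirect_product G U L : Prop :=
  [/\ closed_subgroup U /\ closed_subgroup L,
      (forall u, U u -> G u) /\ (forall l, L l -> G l),
      forall g u, G g -> U u -> U (g \o u \o g^-1)%VF &
      variety_isomorphism
        (fun p : ('End(W) * 'End(W))%type => U p.1 /\ L p.2) G
        (fun p => (p.1 \o p.2)%VF)].

End LinearGroups.

(** The matrix groups Sp_{2m}(k) and their finite products; a product of matrix
    groups is realised by block diagonal matrices. *)
Section MatrixSp.
Variable k : fieldType.

Definition Jmx (m : nat) : 'M[k]_(m + m) := block_mx 0 1%:M (- 1%:M) 0.

Definition Sp_mx (m : nat) (A : 'M[k]_(m + m)) : Prop :=
  A^T *m Jmx m *m A = Jmx m.

Definition Sp_prod (s : nat) (m : 'I_s -> nat)
    (A : 'M[k]_(\sum_i (m i + m i))) : Prop :=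
  exists2 B : forall i, 'M[k]_(m i + m i),
    forall i, Sp_mx (B i) & A = \mxdiag_i B i.

End MatrixSp.

Section Cones.
Variable k : fieldType.

Section Enhanced.
Variable V : vectType k.

(* [e i j] is the vector v_{i+1,j}; the second index starts at 1, and
   [e i 0 = 0]. *)
Definition jordan_basis (lam : seq nat) (x : 'End(V)) (e : nat -> nat -> V) :=
  [/\ forall i, e i 0%N = 0,
      basis_of fullv
        [seq e i j.+1 | i <- iota 0 (size lam), j <- iota 0 (nth 0%N lam i)] &
      forall i j, (i < size lam)%N -> (j < nth 0%N lam i)%N ->
        x (e i j.+1) = e i j].

Definition enhanced_orbit (mu nu : seq nat) (v : V) (x : 'End(V)) : Prop :=
  let lam := part_add mu nu in
  exists2 e, jordan_basis lam x e & v = \sum_(i < size lam) e i (nth 0%N mu i).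

Definition dualspace : vectType k := 'Hom(V, k^o).

Definition Vsum : vectType k := (V * dualspace)%type.

Definition Vsum_form (a b : Vsum) : k := b.2 a.1 - a.2 b.1.

Definition Vsum_end_fun (x : 'End(V)) (a : Vsum) : Vsum :=
  (x a.1, (a.2 \o x)%VF).

Fact Vsum_end_fun_linear x : linear (Vsum_end_fun x).
Proof.
move=> c [u f] [v g]; rewrite /Vsum_end_fun /=.
congr pair; first by rewrite linearP.
by apply/lfunP => u'; rewrite comp_lfunE !add_lfunE !scale_lfunE !comp_lfunE.
Qed.

(* The endomorphism (x, x^t) of V + V^*. *)
Definition Vsum_end (x : 'End(V)) : 'End(Vsum) := linfun (Vsum_end_fun x).

Lemma Vsum_endE x a : Vsum_end x a = (x a.1, (a.2 \o x)%VF).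
Proof.
pose D := GRing.isLinear.Build _ _ _ _ _ (Vsum_end_fun_linear x).
pose L : {linear Vsum -> Vsum} := HB.pack (Vsum_end_fun x) D.
exact: (lfunE L a).
Qed.

End Enhanced.

Section Exotic.
Variables (W : vectType k) (omega : {skew_symmetric W}).

(* Invertibility of g is automatic when omega is nondegenerate. *)
Definition Sp (g : 'End(W)) : Prop :=
  forall a b, omega (g a) (g b) = omega a b.

Definition Sp_act (g : 'End(W)) (p : W * 'End(W)) : W * 'End(W) :=
  (g p.1, (g \o p.2 \o g^-1)%VF).

Definition Sp_stab (p : W * 'End(W)) (g : 'End(W)) : Prop :=
  Sp g /\ Sp_act g p = p.

Variables (V : vectType k) (iota : 'Hom(Vsum V, W)).

Definition cone_embedding (v : V) (x : 'End(V)) : W * 'End(W) :=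
  (iota (v, 0), (iota \o Vsum_end x \o iota^-1)%VF).

(* The identification iota of V + V^* with W should be an isometry. *)
Definition exotic_orbit (mu nu : seq nat) (p : W * 'End(W)) : Prop :=
  exists (v : V) (x g : _),
    [/\ enhanced_orbit mu nu v x, Sp g & p = Sp_act g (cone_embedding v x)].

End Exotic.
End Cones.

(* Main.v *)
Require Import Defs.
From HB Require Import structures.
From mathcomp Require Import all_boot all_order all_algebra.
From mathcomp Require Import zify ring.

Set Implicit Arguments.
Unset Strict Implicit.
Unset Printing Implicit Defensive.

Import GRing.Theory.
Local Open Scope ring_scope.

(** An element [g] of the stabiliser is [1 + X] with [X] in the algebra [H] of the
    [y]-linear maps that kill [w] and have image orthogonal to [w], subject to
    [X^* + X + X^* X = 0].  Such an [X] is the same as a [k[t]]-bilinear form on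
    the torsion module [M = W / k[y]w], so a cyclic basis of [M] turns [H] into
    a space of arrays; on arrays the adjoint is transposition up to sign, and
    the product is governed by the Gram matrix of the dual basis.

    For a suitable basis and a grading of [M] by (a perturbation of) the
    Jacobson-Morozov weights, [H] lives in nonnegative degrees.  Its degree 0
    part is a product of matrix algebras [M_(2r)(k)] with the symplectic
    involution, and projecting to it is multiplicative: this gives the Levi
    factor, and the part [N] of positive degree gives [U].  If [T] denotes the
    strictly upper triangular part, then [T c + (T c)^* = c] for alternating [c],
    so [X |-> X + T (X^* X)] maps [U] bijectively onto the linear space of skew
    elements of [N], the inverse being found by iteration along the grading;
    this works in every characteristic.

    The basis is found by adapting the Jordan basis of [x] so that [v] only
    involves one row for each block in [J].  The dimension of the space of skew
    elements of [H] does not depend on the basis, and is computed with the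
    original Jordan basis, for which the orders of the cyclic summands of [M] are
    [lam_1 >= nu_1 + mu_2 >= lam_2 >= nu_2 + mu_3 >= ...]. *)

(** * Polynomial maps *)

Section PolynomialMaps.
Variable k : fieldType.
Implicit Types X Y Z : vectType k.

(** [M] appears because the form [omega (X a) b] is balanced for [y] and vanishes when one argument
    lies in [k[y]w]. The perturbation of the weights answers an obstacle: the unperturbed ones put
    in degree 0 every pair of generators of equal order, including those that come from [v], so
    degree 0 would exceed the Levi algebra. Lowering by one unit the weight of each generator
    outside the Levi part, with [y] of degree 4, moves such pairs to positive degree. The price is a
    margin in the Gram matrix of the dual basis: its entries between shifted generators must stay
    off the extreme degree. The margin is the drop of [mu] or of [nu] from one row of [v] to the
    next, so both must decrease strictly along the rows involved in [v]. Taking one row in each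
    block of [J] achieves this, and the loss of that row turns [Sp_(2m)] into [Sp_(2m-2)]. For [U],
    a Cayley transform would divide by 2; [T] selects half of the array instead, which is possible
    because [<yu, u> = 0] makes the form of [X^* X] alternating and not only skew-symmetric. *)

Lemma linear_sum_coord X (V : lmodType k) (f : {linear X -> V}) (x : X) :
  f x = \sum_(i < \dim {:X}) coord (vbasis {:X}) i x *: f (vbasis {:X})`_i.
Proof.
rewrite {1}(coord_vbasis (memvf x)) linear_sum.
by apply: eq_bigr => i _; rewrite linearZ.
Qed.

(** Normal form in the coordinates of one fixed basis: two polynomial functions then share their
    indeterminates and can be added and multiplied. *)
Lemma polyfunP X (f : X -> k) :
  polyfun f <-> exists p : {mpoly k[\dim {:X}]},
    forall x, f x = p.@[fun i => coord (vbasis {:X}) i x].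
Proof.
split=> [[m [l [p fE]]]|[p fE]]; last first.
  exists (\dim {:X}), (fun i => linfun (coord (vbasis {:X}) i : X -> k^o)), p.
  by move=> x; rewrite fE; apply: meval_eq => i; rewrite lfunE.
exists (p \mPo [tuple \sum_(j < \dim {:X}) l i (vbasis {:X})`_j *: 'X_j | i < m]) => x.
rewrite fE comp_mpoly_meval; apply: meval_eq => i.
rewrite tnth_mktuple raddf_sum (linear_sum_coord (l i)) /=.
by apply: eq_bigr => j _; rewrite mevalZ mevalXU mulrC.
Qed.

Lemma eq_polyfun X (f g : X -> k) : f =1 g -> polyfun f -> polyfun g.
Proof. by move=> fg [m [l [p fE]]]; exists m, l, p => x; rewrite -fg. Qed.

Lemma polyfun_cst X c : polyfun (fun _ : X => c).
Proof. by apply/polyfunP; exists c%:MP => x; rewrite mevalC. Qed.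

Lemma polyfun_lin X (l : 'Hom(X, k^o)) : polyfun (fun x => l x : k).
Proof.
exists 1%N, (fun _ => l), 'X_ord0 => x.
by rewrite mevalXU.
Qed.

Lemma polyfunD X (f g : X -> k) :
  polyfun f -> polyfun g -> polyfun (fun x => f x + g x).
Proof.
move=> /polyfunP[p fE] /polyfunP[q gE]; apply/polyfunP; exists (p + q) => x.
by rewrite mevalD fE gE.
Qed.

Lemma polyfunM X (f g : X -> k) :
  polyfun f -> polyfun g -> polyfun (fun x => f x * g x).
Proof.
move=> /polyfunP[p fE] /polyfunP[q gE]; apply/polyfunP; exists (p * q) => x.
by rewrite mevalM fE gE.
Qed.

Lemma polyfun_sum X (I : Type) (r : seq I) (f : I -> X -> k) :
  (forall i, polyfun (f i)) -> polyfun (fun x => \sum_(i <- r) f i x).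
Proof.
move=> fP; elim: r => [|i r IHr].
  by apply: eq_polyfun (polyfun_cst X 0) => x; rewrite big_nil.
by apply: eq_polyfun (polyfunD (fP i) IHr) => x; rewrite big_cons.
Qed.

Lemma polyfun_comp X Y (h : X -> Y) (f : Y -> k) :
  (forall l : 'Hom(Y, k^o), polyfun (fun x => l (h x) : k)) ->
  polyfun f -> polyfun (fun x => f (h x)).
Proof.
move=> hP [m [l [p fE]]].
have: polyfun (fun x => p.@[fun i => l i (h x)]); last first.
  by apply: eq_polyfun => x; rewrite fE.
have mX (e : nat) i : polyfun (fun x => (l i (h x) : k) ^+ e).
  elim: e => [|e IHe]; first by apply: eq_polyfun (polyfun_cst X 1) => x; rewrite expr0.
  by apply: eq_polyfun (polyfunM (hP (l i)) IHe) => x; rewrite exprS.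
apply: (@eq_polyfun _ (fun x => \sum_(e <- msupp p)
   p@_e * \prod_(i <- index_enum _) (l i (h x) : k) ^+ e i)) => [x|].
  by rewrite mevalE.
apply: polyfun_sum => e; apply: polyfunM; first exact: polyfun_cst.
elim: (index_enum _) => [|i r IHr].
  by apply: eq_polyfun (polyfun_cst X 1) => x; rewrite big_nil.
by apply: eq_polyfun (polyfunM (mX (e i) i) IHr) => x; rewrite big_cons.
Qed.

(** The isomorphisms built below and their inverses are all polynomial on the whole ambient space,
    so no choice of extension depends on the functional [l]. *)
Definition polymap X Y (f : X -> Y) : Prop :=
  forall l : 'Hom(Y, k^o), polyfun (fun x => l (f x) : k).

Lemma eq_polymap X Y (f g : X -> Y) : f =1 g -> polymap f -> polymap g.
Proof. by move=> fg fP l; apply: eq_polyfun (fP l) => x; rewrite fg. Qed.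

Lemma polymap_cst X Y (c : Y) : polymap (fun _ : X => c).
Proof. by move=> l; apply: polyfun_cst. Qed.

Lemma polymap_lin X Y (f : {linear X -> Y}) : polymap f.
Proof.
move=> l; apply: eq_polyfun (polyfun_lin (l \o linfun f)%VF) => x.
by rewrite comp_lfunE lfunE.
Qed.

Lemma polymap_linear X Y (f : X -> Y) : linear f -> polymap f.
Proof.
move=> fL; pose L : {linear X -> Y} := HB.pack f (GRing.isLinear.Build _ _ _ _ _ fL).
exact: (polymap_lin L).
Qed.

Lemma polymap_comp X Y Z (g : Y -> Z) (f : X -> Y) :
  polymap f -> polymap g -> polymap (fun x => g (f x)).
Proof. by move=> fP gP l; apply: (polyfun_comp (f := fun z => l (g z))). Qed.

Lemma polymapD X Y (f g : X -> Y) :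
  polymap f -> polymap g -> polymap (fun x => f x + g x).
Proof.
by move=> fP gP l; apply: eq_polyfun (polyfunD (fP l) (gP l)) => x; rewrite linearD.
Qed.

Lemma polymapN X Y (f : X -> Y) : polymap f -> polymap (fun x => - f x).
Proof. by move=> fP; apply: polymap_comp fP (polymap_lin _). Qed.

Lemma polymapB X Y (f g : X -> Y) :
  polymap f -> polymap g -> polymap (fun x => f x - g x).
Proof. by move=> fP gP; apply: polymapD fP (polymapN gP). Qed.

Lemma polymap_sum X Y (I : Type) (r : seq I) (f : I -> X -> Y) :
  (forall i, polymap (f i)) -> polymap (fun x => \sum_(i <- r) f i x).
Proof.
move=> fP l.
apply: (eq_polyfun (f := fun x => \sum_(i <- r) (l (f i x) : k))) => [x|].
  by rewrite linear_sum.
by apply: polyfun_sum => i; apply: fP.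
Qed.

Lemma polymapZ X Y (f : X -> k) (g : X -> Y) :
  polyfun f -> polymap g -> polymap (fun x => f x *: g x).
Proof.
by move=> fP gP l; apply: eq_polyfun (polyfunM fP (gP l)) => x; rewrite linearZ.
Qed.

Lemma polymap_pair X Y Z (f : X -> Y) (g : X -> Z) :
  polymap f -> polymap g -> polymap (fun x => (f x, g x) : (Y * Z)%type).
Proof.
pose i1 (u : Y) : (Y * Z)%type := (u, 0).
pose i2 (u : Z) : (Y * Z)%type := (0, u).
have i1L : linear i1 by move=> c u v; congr pair; rewrite /= ?scaler0 ?addr0.
have i2L : linear i2 by move=> c u v; congr pair; rewrite /= ?scaler0 ?addr0.
pose I1 : {linear Y -> (Y * Z)%type} := HB.pack i1 (GRing.isLinear.Build _ _ _ _ _ i1L).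
pose I2 : {linear Z -> (Y * Z)%type} := HB.pack i2 (GRing.isLinear.Build _ _ _ _ _ i2L).
move=> fP gP; have := polymapD (polymap_comp fP (polymap_lin I1))
   (polymap_comp gP (polymap_lin I2)).
by apply: eq_polymap => x; congr pair; rewrite /= ?addr0 ?add0r.
Qed.

Lemma polymap_comp_lfun X Y (f g : X -> 'End(Y)) :
  polymap f -> polymap g -> polymap (fun x => (f x \o g x)%VF).
Proof.
move=> fP gP.
pose b := vbasis {: 'End(Y)}.
apply: (@eq_polymap _ _ (fun x => \sum_(i < \dim {: 'End(Y)})
  coord b i (f x) *: \sum_(j < \dim {: 'End(Y)})
   coord b j (g x) *: (b`_i \o b`_j)%VF)) => [x|].
  apply/lfunP => u; rewrite sum_lfunE comp_lfunE.
  rewrite {2}(coord_vbasis (memvf (f x))) sum_lfunE; apply: eq_bigr => i _.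
  rewrite !scale_lfunE; congr (_ *: _).
  rewrite {2}(coord_vbasis (memvf (g x))) !sum_lfunE linear_sum /=.
  by apply: eq_bigr => j _; rewrite !scale_lfunE linearZ comp_lfunE.
have cP (h : X -> 'End(Y)) i : polymap h -> polyfun (fun x => coord b i (h x)).
  move=> hP; apply: eq_polyfun (hP (linfun (coord b i : _ -> k^o))) => x.
  by rewrite lfunE.
by apply: polymap_sum => i; apply: polymapZ (cP _ _ fP) _;
  apply: polymap_sum => j; apply: polymapZ (cP _ _ gP) (polymap_cst _ _).
Qed.

Lemma zariski_closed_zeros X (I : Type) (Y : I -> vectType k) (f : forall i, X -> Y i) :
  (forall i, polymap (f i)) -> zariski_closed (fun x => forall i, f i x = 0).
Proof.
move=> fP.
exists (fun h => exists i (l : 'Hom(Y i, k^o)), h = fun x => l (f i x)); split.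
  by move=> _ [i [l ->]]; apply: fP.
move=> x; split=> [f0 _ [i [l ->]]|h0 i]; first by rewrite f0 linear0.
rewrite (coord_vbasis (memvf (f i x))) big1 // => j _.
have := h0 _ (ex_intro _ i (ex_intro _
  (linfun (coord (vbasis {: Y i}) j : _ -> k^o)) (erefl _))).
by rewrite lfunE /= => ->; rewrite scale0r.
Qed.

Lemma eq_zariski_closed X (A B : X -> Prop) :
  (forall x, A x <-> B x) -> zariski_closed A -> zariski_closed B.
Proof.
by move=> AB [F [FP FE]]; exists F; split=> // x; rewrite -AB.
Qed.

Lemma zariski_closedI X (A B : X -> Prop) :
  zariski_closed A -> zariski_closed B -> zariski_closed (fun x => A x /\ B x).
Proof.
move=> [F [FP FE]] [E [EP EE]]; exists (fun f => F f \/ E f); split.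
  by move=> f [/FP|/EP].
move=> x; split=> [[/FE Fx /EE Ex] f []|h]; [exact: Fx|exact: Ex|].
by split; [apply/FE|apply/EE] => f fP; apply: h; [left|right].
Qed.

Lemma morphism_of_polymap X Y (A : X -> Prop) (B : Y -> Prop) (f : X -> Y) :
  polymap f -> (forall x, A x -> B (f x)) -> morphism_of_varieties A B f.
Proof. by move=> fP AB; split=> // l; exists (fun x => l (f x)). Qed.

End PolynomialMaps.

(** * The stabiliser in coordinates *)

Lemma sum_ord_only (V : nmodType) n j (F : nat -> V) :
  (forall b, (b < n)%N -> b != j -> F b = 0) ->
  \sum_(b < n) F b = if (j < n)%N then F j else 0.
Proof.
move=> F0; case: ltnP => [lt_jn|le_nj].
  rewrite (bigD1 (Ordinal lt_jn)) //= big1 ?addr0 // => b ne_bj.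
  by apply: F0 => //; apply: contraNneq ne_bj => eq_bj; apply/eqP/val_inj.
by rewrite big1 // => b _; apply: F0 => //; rewrite neq_ltn (leq_trans (ltn_ord b)).
Qed.

Lemma sum_only (V : nmodType) (I : finType) i (F : I -> V) :
  (forall b, b != i -> F b = 0) -> \sum_b F b = F i.
Proof. by move=> F0; rewrite (bigD1 i) //= big1 ?addr0. Qed.

Lemma mul_mxdiag (R : pzSemiRingType) (s : nat) (n : 'I_s -> nat)
    (A B : forall i, 'M[R]_(n i)) :
  \mxdiag_i A i *m \mxdiag_i B i = \mxdiag_i (A i *m B i).
Proof.
rewrite {2}/mxdiag mul_mxdiag_mxblock; apply/eq_mxblock => i j.
by case: eqVneq => [eq_ij|_]; [case: j / eq_ij; rewrite !conform_mx_id|rewrite mulmx0].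
Qed.

Lemma scale_mxdiag (R : comPzRingType) (s : nat) (n : 'I_s -> nat) a
    (A : forall i, 'M[R]_(n i)) :
  a *: \mxdiag_i A i = \mxdiag_i (a *: A i).
Proof.
rewrite -mul_scalar_mx -mxdiagZ mul_mxdiag.
by apply: eq_mxdiag => i; rewrite mul_scalar_mx.
Qed.

Lemma Jmx_sqr (k : fieldType) n : Jmx k n *m Jmx k n = - 1%:M.
Proof.
rewrite /Jmx mulmx_block !mul0mx !mulmx0 mul1mx mulmx1 !addr0 !add0r.
by rewrite (scalar_mx_block _ _ 1) opp_block_mx !oppr0.
Qed.

Lemma Jmx_tr (k : fieldType) n : (Jmx k n)^T = - Jmx k n.
Proof. by rewrite /Jmx tr_block_mx opp_block_mx !linear0 linearN /= tr_scalar_mx opprK. Qed.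

Section Frame.
Variables (k : fieldType) (W : vectType k) (omega : {skew_symmetric W}).
Variables (y : 'End(W)) (w : W).
Hypothesis om_nondeg : forall a, (forall b, omega a b = 0) -> a = 0.
Hypothesis om_alt : forall a, omega a a = 0.
Hypothesis om_y : forall a b, omega (y a) b = omega a (y b).
Hypothesis om_y_alt : forall a, omega (y a) a = 0.

Lemma omC a b : omega a b = - omega b a.
Proof. by rewrite (hermC omega) /= expr1 mulN1r. Qed.

Lemma omZl c a b : omega (c *: a) b = c * omega a b.
Proof. by rewrite linearZl_LR. Qed.

Lemma omZr c a b : omega a (c *: b) = c * omega a b.
Proof. by rewrite linearZr_LR. Qed.

Lemma omDl a b c : omega (a + b) c = omega a c + omega b c.
Proof. exact: linearDl. Qed.

Lemma omDr a b c : omega a (b + c) = omega a b + omega a c.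
Proof. exact: linearDr. Qed.

Definition ypow c : 'End(W) := iter c (fun f => (y \o f)%VF) \1%VF.

Lemma ypow0 u : ypow 0 u = u. Proof. by rewrite /ypow /= id_lfunE. Qed.
Lemma ypowS c u : ypow c.+1 u = y (ypow c u). Proof. by rewrite /ypow /= comp_lfunE. Qed.

Lemma ypowD a b u : ypow (a + b) u = ypow a (ypow b u).
Proof. by elim: a => [|a IHa]; rewrite ?ypow0 // addSn !ypowS IHa. Qed.

Lemma om_ypow c a b : omega (ypow c a) b = omega a (ypow c b).
Proof.
elim: c b => [|c IHc] b; first by rewrite !ypow0.
by rewrite [in LHS]ypowS om_y IHc -addn1 ypowD ypowS ypow0.
Qed.

(** Half of the power moves to the other side: with [u = ypow c./2 a] this is [omega u u] or
    [omega (y u) u], according to the parity of [c]. *)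
Lemma om_ypow_alt c a : omega (ypow c a) a = 0.
Proof.
rewrite -(odd_double_half c) -addnn addnA ypowD om_ypow -om_ypow.
by case: (odd c); rewrite addnC ypowD om_ypow ?ypowS ?ypow0.
Qed.

(* [Sp_stab omega (w, y) g] means [Sp omega g] and [inH (g - 1)]. *)
Definition inH (X : 'End(W)) :=
  [/\ forall u, X (y u) = y (X u), X w = 0 & forall u, omega (X u) w = 0].

Lemma inH_ypow X c u : inH X -> X (ypow c u) = ypow c (X u).
Proof.
by move=> [Xy _ _]; elim: c => [|c IHc]; rewrite ?ypow0 // !ypowS Xy IHc.
Qed.

Lemma inH0 : inH 0.
Proof. by split=> *; rewrite !zero_lfunE ?linear0 ?linear0l. Qed.

Lemma inHZD c X Y : inH X -> inH Y -> inH (c *: X + Y).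
Proof.
move=> [X1 X2 X3] [Y1 Y2 Y3]; split=> [u||u].
- by rewrite !add_lfunE !scale_lfunE X1 Y1 linearD linearZ.
- by rewrite !add_lfunE !scale_lfunE X2 Y2 scaler0 addr0.
- by rewrite !add_lfunE !scale_lfunE linearDl /= omZl X3 Y3 mulr0 addr0.
Qed.

Lemma inHD X Y : inH X -> inH Y -> inH (X + Y).
Proof. by move=> hX hY; rewrite -[X]scale1r; apply: inHZD. Qed.

Lemma inHN X : inH X -> inH (- X).
Proof. by move=> hX; rewrite -scaleN1r -[_ *: X]addr0; apply: inHZD inH0. Qed.

Lemma inHB X Y : inH X -> inH Y -> inH (X - Y).
Proof. by move=> hX hY; apply: inHD hX (inHN hY). Qed.

Lemma inHM X Y : inH X -> inH Y -> inH (X \o Y)%VF.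
Proof.
move=> [X1 X2 X3] [Y1 Y2 Y3]; split=> [u||u]; rewrite !comp_lfunE //.
  by rewrite Y1 X1.
by rewrite Y2 linear0.
Qed.

(* A frame of W / k[y]w: [m p] generates a cyclic summand of order [o p], and
   the [ms p] are dual to the [m p]. *)
Variables (P : finType) (o : P -> nat) (m ms : P -> W).
Hypothesis frame_dual : forall a p q,
  omega (ypow a (ms p)) (m q) = ((p == q) && (a.+1 == o p))%:R.
Hypothesis frame_w : forall a p, omega (ypow a (ms p)) w = 0.
Hypothesis frame_span : forall f : 'Hom(W, k^o),
  (forall p j, f (ypow j (m p)) = 0) -> forall u, f u = 0.
Hypothesis frame_ord : forall p, exists a c, ypow (o p) (m p) = a *: ypow c w.

Lemma frame_sep u : (forall p j, omega u (ypow j (m p)) = 0) -> u = 0.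
Proof.
move=> u0; apply: om_nondeg => b.
have E : linfun (omega u : W -> k^o) b = 0.
  by apply: frame_span => p j; rewrite lfunE /= u0.
by rewrite lfunE in E.
Qed.

Lemma frame_ext (X Y : 'End(W)) :
  (forall p j, X (ypow j (m p)) = Y (ypow j (m p))) -> X = Y.
Proof.
move=> XY; apply/eqP; rewrite -subr_eq0; apply/eqP/lfunP => u.
rewrite zero_lfunE; apply: om_nondeg => b.
have E : (linfun (applyr omega b : W -> k^o) \o (X - Y))%VF u = 0.
  apply: frame_span => p j.
  by rewrite comp_lfunE lfunE add_lfunE opp_lfunE XY subrr linear0.
by rewrite comp_lfunE lfunE in E.
Qed.

(* The coefficients of the form [omega (X a) b]; it only depends on the exponent
   of [y], as [X] commutes with [y]. *)
Definition cf (X : 'End(W)) p q j := omega (X (ypow j (m p))) (m q).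

Lemma cfZD c X Y p q j : cf (c *: X + Y) p q j = c * cf X p q j + cf Y p q j.
Proof. by rewrite /cf add_lfunE scale_lfunE linearDl /= omZl. Qed.

Lemma cfD X Y p q j : cf (X + Y) p q j = cf X p q j + cf Y p q j.
Proof. by rewrite -[X]scale1r cfZD scale1r mul1r. Qed.

Lemma cf0 p q j : cf 0 p q j = 0.
Proof. by rewrite /cf zero_lfunE linear0l. Qed.

Lemma cfN X p q j : cf (- X) p q j = - cf X p q j.
Proof. by rewrite /cf opp_lfunE linearNl. Qed.

Lemma cf_inj X Y : inH X -> inH Y ->
  (forall p q j, cf X p q j = cf Y p q j) -> X = Y.
Proof.
move=> hX hY eqXY; apply: frame_ext => p j.
apply/eqP; rewrite -subr_eq0; apply/eqP/frame_sep => q i.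
rewrite -om_ypow linearB /= -!(inH_ypow _ _ hX) -!(inH_ypow _ _ hY) -!ypowD.
by rewrite linearBl /=; have := eqXY p q (i + j)%N; rewrite /cf => ->; rewrite subrr.
Qed.

(** [X] kills [k[y]w], which contains [ypow (o p) (m p)]; dually, the image of [X] is orthogonal to
    [k[y]w], which gives the bound by [o q]. *)
Lemma cf_out X p q j : inH X -> (minn (o p) (o q) <= j)%N -> cf X p q j = 0.
Proof.
move=> hX; have [_ Xw wX] := hX; rewrite geq_min => /orP[] le_j; rewrite /cf.
  have [a [c E]] := frame_ord p.
  rewrite -(subnK le_j) ypowD E !linearZ /= -ypowD (inH_ypow _ _ hX) Xw.
  by rewrite !linear0 linear0l.
have [a [c E]] := frame_ord q.
rewrite (inH_ypow _ _ hX) om_ypow -(subnK le_j) ypowD E [ypow _ (_ *: _)]linearZ /= -ypowD.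
by rewrite omZr -om_ypow -(inH_ypow _ _ hX) wX mulr0.
Qed.

(* [Ar c] is the element of [inH] whose coefficients are given by [c], restricted
   to the range [j < minn (o p) (o q)] of possible exponents. *)
Definition arow (c : P -> P -> nat -> k) p : W :=
  \sum_q \sum_(j < minn (o p) (o q)) c p q j *: ypow ((o q).-1 - j) (ms q).

(** The scalar reads off the coordinate of [u] along [ypow b (m p)] modulo [k[y]w]; that vector is
    sent to [ypow b (arow c p)]. *)
Definition arr_fun c (u : W) : W :=
  \sum_p \sum_(b < o p) omega (ypow ((o p).-1 - b) (ms p)) u *: ypow b (arow c p).

Fact arr_fun_linear c : linear (arr_fun c).
Proof.
move=> a u v; rewrite /arr_fun scaler_sumr -big_split; apply: eq_bigr => p _ /=.
rewrite scaler_sumr -big_split; apply: eq_bigr => b _ /=.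
by rewrite linearDr /= omZr scalerDl scalerA.
Qed.

Definition Ar c : 'End(W) := linfun (arr_fun c).

Lemma ArE c u : Ar c u =
  \sum_p \sum_(b < o p) omega (ypow ((o p).-1 - b) (ms p)) u *: ypow b (arow c p).
Proof.
pose L : {linear W -> W} :=
  HB.pack (arr_fun c) (GRing.isLinear.Build _ _ _ _ _ (arr_fun_linear c)).
exact: (lfunE L u).
Qed.

Lemma eq_Ar c d : (forall p q j, c p q j = d p q j) -> Ar c = Ar d.
Proof.
move=> cd; apply/lfunP => u; rewrite !ArE; apply: eq_bigr => p _.
apply: eq_bigr => b _; congr (_ *: ypow _ _); apply: eq_bigr => q _.
by apply: eq_bigr => j _; rewrite cd.
Qed.

Lemma ArZD a c d :
  Ar (fun p q j => a * c p q j + d p q j) = a *: Ar c + Ar d.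
Proof.
have rowE p : arow (fun p q j => a * c p q j + d p q j) p = a *: arow c p + arow d p.
  rewrite /arow scaler_sumr -big_split; apply: eq_bigr => q _ /=.
  rewrite scaler_sumr -big_split; apply: eq_bigr => j _ /=.
  by rewrite scalerDl scalerA.
apply/lfunP => u; rewrite add_lfunE scale_lfunE !ArE scaler_sumr -big_split.
apply: eq_bigr => p _ /=; rewrite scaler_sumr -big_split; apply: eq_bigr => b _ /=.
by rewrite rowE linearP /= scalerDr !scalerA mulrC.
Qed.

Lemma om_arow c p q j : omega (ypow j (arow c p)) (m q) =
  if (j < minn (o p) (o q))%N then c p q j else 0.
Proof.
rewrite /arow linear_sum linear_sumlz /= (sum_only (i := q)) => [|r ne_rq].
  rewrite linear_sum linear_sumlz /=.
  rewrite (sum_ord_only (j := j) (F := fun i =>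
     omega (ypow j (c p q i *: ypow ((o q).-1 - i) (ms q))) (m q))).
    case: ifP => // lt_j.
    rewrite linearZ /= omZl -ypowD frame_dual eqxx /=; case: eqP; rewrite ?mulr1 //.
    by move: lt_j; rewrite leq_min; lia.
  move=> b; rewrite leq_min => /andP[_ lt_b] ne_bj.
  by rewrite linearZ /= omZl -ypowD frame_dual eqxx /=; case: eqP; rewrite ?mulr0 //; lia.
rewrite linear_sum linear_sumlz big1 // => i _.
by rewrite linearZ /= omZl -ypowD frame_dual (negPf ne_rq) mulr0.
Qed.

(** This is what the truncation of the exponents in [arow] is for: it makes [Ar c] commute with
    [y]. *)
Lemma ypow_arow0 c p j : (o p <= j)%N -> ypow j (arow c p) = 0.
Proof.
move=> le_j; apply: frame_sep => q i; rewrite -om_ypow -ypowD om_arow.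
by case: ifP => //; rewrite leq_min; lia.
Qed.

Lemma Ar_m c p j : Ar c (ypow j (m p)) = ypow j (arow c p).
Proof.
rewrite ArE (sum_only (i := p)) => [|r ne_rp]; last first.
  by rewrite big1 // => b _; rewrite -om_ypow -ypowD frame_dual (negPf ne_rp) scale0r.
rewrite (sum_ord_only (j := j) (F := fun b =>
   omega (ypow ((o p).-1 - b) (ms p)) (ypow j (m p)) *: ypow b (arow c p))).
  case: ltnP => [lt_j|le_j]; last by rewrite ypow_arow0.
  rewrite -om_ypow -ypowD frame_dual eqxx /=; case: eqP; rewrite ?scale1r //; lia.
move=> b lt_b ne_bj; rewrite -om_ypow -ypowD frame_dual eqxx /=.
by case: eqP; rewrite ?scale0r //; lia.
Qed.

Lemma cf_Ar c p q j :
  cf (Ar c) p q j = if (j < minn (o p) (o q))%N then c p q j else 0.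
Proof. by rewrite /cf Ar_m om_arow. Qed.

Lemma inH_Ar c : inH (Ar c).
Proof.
split=> [u||u].
- have: (Ar c \o y = y \o Ar c)%VF.
    apply: frame_ext => p j.
    by rewrite !comp_lfunE -ypowS !Ar_m ypowS.
  by move=> /lfunP/(_ u); rewrite !comp_lfunE.
- by rewrite ArE big1 // => p _; rewrite big1 // => b _; rewrite frame_w scale0r.
- rewrite ArE linear_sumlz big1 // => p _; rewrite linear_sumlz big1 // => b _ /=.
  rewrite omZl linear_sum linear_sumlz big1 ?mulr0 // => q _.
  rewrite linear_sum linear_sumlz big1 ?mulr0 // => j _ /=.
  by rewrite linearZ /= omZl -ypowD frame_w mulr0.
Qed.

Lemma Ar_cf X : inH X -> Ar (cf X) = X.
Proof.
move=> hX; apply: cf_inj => // [|p q j]; first exact: inH_Ar.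
by rewrite cf_Ar; case: ltnP => // le_j; rewrite cf_out.
Qed.

Definition gram s r c := omega (ypow c (ms s)) (ms r).

(** [Y (m p)] is a combination of the dual vectors of index [r], and [X] reads coordinates through
    those of index [s]; pairing the two leaves the Gram matrix. *)
Lemma cf_comp X Y p q j : inH X -> inH Y -> cf (X \o Y)%VF p q j =
  \sum_s \sum_(i < o s) \sum_r \sum_(b < minn (o p) (o r))
     cf Y p r b * cf X s q i * gram s r ((o s).-1 - i + (j + ((o r).-1 - b))).
Proof.
move=> hX hY; rewrite /cf comp_lfunE -{1}(Ar_cf hX) -{1}(Ar_cf hY) Ar_m ArE.
rewrite linear_sumlz; apply: eq_bigr => s _; rewrite linear_sumlz.
apply: eq_bigr => i _ /=; rewrite omZl om_arow.
have -> : (if (i < minn (o s) (o q))%N then cf X s q i else 0) = cf X s q i.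
  by case: ltnP => // le_i; rewrite cf_out.
rewrite linear_sum linear_sumr mulr_suml; apply: eq_bigr => r _.
rewrite linear_sum linear_sumr mulr_suml; apply: eq_bigr => b _ /=.
rewrite linearZ /= omZr /gram !ypowD -!om_ypow /cf.
have -> (a b' : nat) u v : omega (ypow a (ypow b' u)) v = omega (ypow b' (ypow a u)) v.
  by rewrite -!ypowD addnC.
rewrite mulrAC !om_ypow; congr (_ * _ * _).
by rewrite -!ypowD; congr (omega _ (ypow _ _)); lia.
Qed.

(* The adjoint of [X], for [X] in [inH]. *)
Definition sg X : 'End(W) := Ar (fun p q j => - cf X q p j).

Lemma inH_sg X : inH (sg X). Proof. exact: inH_Ar. Qed.

Lemma cf_sg X p q j : inH X -> cf (sg X) p q j = - cf X q p j.
Proof.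
by move=> hX; rewrite cf_Ar minnC; case: ltnP => // le_j; rewrite cf_out ?oppr0.
Qed.

Lemma om_sg X a b : inH X -> omega (sg X a) b = omega a (X b).
Proof.
move=> hX.
suff h p j c : omega (sg X (ypow j (m p))) c = omega (ypow j (m p)) (X c).
  have E : (linfun (applyr omega b : W -> k^o) \o sg X
    - linfun (applyr omega (X b) : W -> k^o))%VF a = 0.
    apply: frame_span => p j.
    by rewrite add_lfunE opp_lfunE comp_lfunE !lfunE /= h subrr.
  rewrite add_lfunE opp_lfunE comp_lfunE !lfunE /= in E.
  by apply/eqP; rewrite -subr_eq0; apply/eqP.
have E : (linfun (omega (sg X (ypow j (m p))) : W -> k^o)
    - (linfun (omega (ypow j (m p)) : W -> k^o) \o X))%VF c = 0; last first.
  rewrite add_lfunE opp_lfunE comp_lfunE !lfunE /= in E.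
  by apply/eqP; rewrite -subr_eq0; apply/eqP.
apply: frame_span => q i; rewrite add_lfunE opp_lfunE comp_lfunE !lfunE /=.
rewrite -om_ypow -(inH_ypow _ _ (inH_sg X)) -ypowD -/(cf _ _ _ _) cf_sg //.
by rewrite [X in _ - X]omC -om_ypow -(inH_ypow _ _ hX) -ypowD addnC subrr.
Qed.

Lemma adj_uniq (X Y : 'End(W)) :
  (forall a b, omega (X a) b = omega (Y a) b) -> X = Y.
Proof.
move=> XY; apply/lfunP => u; apply/eqP; rewrite -subr_eq0; apply/eqP/om_nondeg => b.
by rewrite linearBl /= XY subrr.
Qed.

Lemma sgZD c X Y : sg (c *: X + Y) = c *: sg X + sg Y.
Proof.
by rewrite /sg -ArZD; apply: eq_Ar => p q j; rewrite cfZD opprD mulrN.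
Qed.

Lemma sgD X Y : sg (X + Y) = sg X + sg Y.
Proof. by rewrite -[X]scale1r sgZD !scale1r. Qed.

Lemma sg0 : sg 0 = 0.
Proof. by have := sgZD (-1) 0 0; rewrite scaler0 addr0 scaleN1r addNr. Qed.

Lemma sgN X : sg (- X) = - sg X.
Proof. by rewrite -scaleN1r -[_ *: X]addr0 sgZD sg0 addr0 scaleN1r. Qed.

Lemma Sp1P X : inH X ->
  Sp omega (\1 + X)%VF <-> sg X + X + (sg X \o X)%VF = 0.
Proof.
move=> hX.
have E a b : omega ((\1 + X)%VF a) ((\1 + X)%VF b) =
    omega a b + omega ((sg X + X + (sg X \o X)%VF) a) b.
  rewrite !add_lfunE !id_lfunE comp_lfunE !(omDl, omDr) !om_sg //.
  by ring.
split=> [S|S0 a b]; last by rewrite E S0 zero_lfunE linear0l addr0.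
apply: adj_uniq => a b; have := S a b; rewrite E zero_lfunE linear0l => /eqP.
by rewrite -subr_eq0 addrAC subrr add0r => /eqP.
Qed.

Definition ord_bound := (\max_p o p)%N.

Lemma sg_oppP X : inH X ->
  sg X = - X <-> forall a b, omega a (X b) = - omega (X a) b.
Proof.
move=> hX; split=> [sgX a b|E].
  by rewrite -om_sg // sgX opp_lfunE linearNl.
by apply: adj_uniq => a b; rewrite om_sg // E opp_lfunE linearNl.
Qed.

(** * Linear coordinates on the skew elements *)

Section Chart.
Variable g : P -> P -> nat -> bool.
Hypothesis gC : forall p q j, g p q j = g q p j.

(** The adjoint is minus the transposition, so a skew element has a symmetric array: one position
    out of [(p, q)] and [(q, p)] is kept, and the whole diagonal. *)
Definition in_chart (x : P * P * 'I_ord_bound) :=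
  [&& x.2 < minn (o x.1.1) (o x.1.2),
      enum_rank x.1.1 <= enum_rank x.1.2 & g x.1.1 x.1.2 x.2]%N.

Definition chart_idx := [set x | in_chart x].

Definition chart_dim := #|chart_idx|.

Definition idx_at (i : 'I_chart_dim) : P * P * 'I_ord_bound := enum_val i.

Lemma idx_atP i : in_chart (idx_at i).
Proof. by have := enum_valP i; rewrite inE. Qed.

Lemma idx_at_inj : injective idx_at. Proof. exact: enum_val_inj. Qed.

Definition at_idx (x : P * P * 'I_ord_bound) p q j :=
  (x.2 == j :> nat) && ((x.1 == (p, q)) || (x.1 == (q, p))).

(* Array coordinates on the skew elements whose coefficients vanish outside [g]. *)
Definition chart_inv (r : 'rV[k]_chart_dim) : 'End(W) :=
  Ar (fun p q j => \sum_i if at_idx (idx_at i) p q j then r 0 i else 0).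

Definition chart (X : 'End(W)) : 'rV[k]_chart_dim :=
  \row_i cf X (idx_at i).1.1 (idx_at i).1.2 (idx_at i).2.

Lemma chart_linear : linear chart.
Proof. by move=> c X Y; apply/rowP => i; rewrite !mxE cfZD. Qed.

Lemma chart_inv_linear : linear chart_inv.
Proof.
move=> c r s; rewrite /chart_inv -ArZD; apply: eq_Ar => p q j.
rewrite mulr_sumr -big_split; apply: eq_bigr => i _ /=.
by case: ifP; rewrite ?mxE // mulr0 addr0.
Qed.

Lemma at_idxC x p q j : at_idx x p q j = at_idx x q p j.
Proof. by rewrite /at_idx orbC. Qed.

Lemma cf_chart_inv r p q j : cf (chart_inv r) p q j =
  \sum_i if at_idx (idx_at i) p q j then r 0 i else 0.
Proof.
rewrite cf_Ar; case: ltnP => // le_j; rewrite big1 // => i _; case: ifP => //.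
have := idx_atP i; rewrite /in_chart => /and3P[lt_i _ _] /andP[/eqP ij ip].
by move: lt_i; rewrite ij; case/orP: ip => /eqP -> /=; lia.
Qed.

Lemma chart_invK : cancel chart_inv chart.
Proof.
move=> r; apply/rowP => i; rewrite mxE cf_chart_inv (sum_only (i := i)).
  by rewrite /at_idx -surjective_pairing !eqxx.
move=> i' ne_i; case: ifP => // /andP[/eqP j_i p_i]; case/eqP: ne_i; apply: idx_at_inj.
have := idx_atP i; have := idx_atP i'; rewrite /in_chart => /and3P[_ r' _] /and3P[_ r0 _].
move: j_i p_i r' r0; case: (idx_at i') => [[p' q'] j']; case: (idx_at i) => [[p q] l] /=.
move=> /val_inj -> /orP[/eqP[-> ->] //|/eqP[-> ->]] r1 r2; congr (_, _, _).
  by apply/enum_rank_inj/val_inj/eqP; rewrite eqn_leq r1 r2.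
by apply/enum_rank_inj/val_inj/eqP; rewrite eqn_leq r1 r2.
Qed.

Lemma inH_chart_inv r : inH (chart_inv r). Proof. exact: inH_Ar. Qed.

Lemma sg_chart_inv r : sg (chart_inv r) = - chart_inv r.
Proof.
apply: (cf_inj (inH_Ar _) (inHN (inH_Ar _))) => p q j.
rewrite (cf_sg _ _ _ (inH_chart_inv r)) cfN !cf_chart_inv; congr (- _).
by apply: eq_bigr => i _; rewrite at_idxC.
Qed.

Lemma cf_chart_inv0 r p q j : ~~ g p q j -> cf (chart_inv r) p q j = 0.
Proof.
move=> ng; rewrite cf_chart_inv big1 // => i _; case: ifP => //.
have := idx_atP i; rewrite /in_chart => /and3P[_ _ gi] /andP[/eqP ij ip].
by case/negP: ng; rewrite -ij; move: gi; case/orP: ip => /eqP -> //=; rewrite gC.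
Qed.

Lemma chartK X : inH X -> sg X = - X ->
  (forall p q j, ~~ g p q j -> cf X p q j = 0) -> chart_inv (chart X) = X.
Proof.
move=> hX sgX X0; apply: cf_inj => // [|p q j]; first exact: inH_Ar.
have symX p' q' : cf X p' q' j = cf X q' p' j.
  by apply: oppr_inj; rewrite -cfN -sgX cf_sg.
wlog le_pq : p q / (enum_rank p <= enum_rank q)%N.
  move=> th; case: (leqP (enum_rank p) (enum_rank q)) => [|/ltnW] /th //.
  rewrite symX => <-; rewrite !cf_chart_inv.
  by apply: eq_bigr => i _; rewrite at_idxC.
have [gp|ng] := boolP (g p q j); last by rewrite cf_chart_inv0 // X0.
have [le_j|lt_j] := leqP (minn (o p) (o q)) j.
  by rewrite !cf_out //; apply: inH_Ar.
have lt_jB : (j < ord_bound)%N.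
  apply: leq_trans lt_j _; rewrite geq_min; apply/orP; left.
  exact: (leq_bigmax (F := o)).
have xin : (p, q, Ordinal lt_jB) \in chart_idx by rewrite inE /in_chart /= lt_j le_pq gp.
have Ei : idx_at (enum_rank_in xin (p, q, Ordinal lt_jB)) = (p, q, Ordinal lt_jB).
  by rewrite /idx_at enum_rankK_in.
rewrite cf_chart_inv (sum_only (i := enum_rank_in xin (p, q, Ordinal lt_jB))).
  by rewrite mxE Ei /at_idx !eqxx.
move=> i ne_i; case: ifP => // /andP[/eqP ij ip]; case/eqP: ne_i.
apply: idx_at_inj; rewrite Ei.
have := idx_atP i; rewrite /in_chart => /and3P[_ + _].
move: ij ip; case: (idx_at i) => [[p' q'] j'] /= ij ip le_pq'.
have -> : j' = Ordinal lt_jB by apply: val_inj.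
case/orP: ip => /eqP [E1 E2]; rewrite ?E1 ?E2 //; congr (_, _, _).
  by apply/enum_rank_inj/val_inj/eqP; rewrite eqn_leq le_pq -E1 -E2 le_pq'.
by apply/enum_rank_inj/val_inj/eqP; rewrite eqn_leq le_pq -E1 -E2 le_pq'.
Qed.

(** Doubling removes the enumeration order of [P]: each off-diagonal position occurs twice in the
    full square, and the diagonal is added once more. *)
Lemma double_chart_dim : (2 * chart_dim =
  \sum_p \sum_q \sum_(j < minn (o p) (o q)) g p q j + \sum_p \sum_(j < o p) g p p j)%N.
Proof.
pose f p q := (\sum_(j < minn (o p) (o q)) g p q j)%N.
have fC p q : f p q = f q p.
  by rewrite /f minnC; apply: eq_bigr => j _; rewrite gC.
have E : chart_dim = (\sum_p \sum_q (enum_rank p <= enum_rank q) * f p q)%N.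
  have -> : chart_dim = (\sum_(u : P * P) \sum_(j < ord_bound) ((u, j) \in chart_idx))%N.
    rewrite /chart_dim -sum1_card big_mkcond pair_big /=.
    by apply: eq_bigr => -[u j] _ /=; case: ifP.
  rewrite [RHS]pair_big /=.
  apply: eq_bigr => [[p q]] _ /=.
  case: (boolP (enum_rank p <= enum_rank q)%N) => le_pq; last first.
    by rewrite mul0n big1 // => j _; rewrite inE /in_chart /= (negPf le_pq) andbF.
  rewrite mul1n /f.
  have le_B : (minn (o p) (o q) <= ord_bound)%N.
    by rewrite geq_min (leq_bigmax (F := o)).
  rewrite (big_ord_widen _ (fun j => g p q j : nat) le_B) [RHS]big_mkcond /=.
  by apply: eq_bigr => j _; rewrite inE /in_chart /= le_pq; case: ltnP => //=; case: (g p q j).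
rewrite mul2n -addnn {2}E exchange_big E -big_split -big_split; apply: eq_bigr => p _ /=.
rewrite -big_split (bigD1 p) //=.
have -> : (\sum_(j < o p) g p p j = f p p)%N by rewrite /f minnn.
have -> : (\sum_q \sum_(j < minn (o p) (o q)) g p q j = \sum_q f p q)%N by [].
rewrite leqnn !mul1n [in RHS](bigD1 p) //= addnAC; congr (_ + _ + _)%N.
apply: eq_bigr => q ne_pq; rewrite (fC q p) -mulnDl.
case: ltngtP => [||/val_inj/enum_rank_inj eq_pq]; rewrite ?mul1n //.
by rewrite eq_pq eqxx in ne_pq.
Qed.

End Chart.

(** * The grading and its degree 0 part *)

Variable lev : pred P.
Hypothesis gram_deg : forall s r c, gram s r c != 0 ->
  (4 * c.+1 + ~~ lev s + ~~ lev r <= 2 * (o s + o r))%N.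
Hypothesis gram_lev : forall s r c, lev s -> gram s r c != 0 ->
  [/\ lev r, o r = o s & o s = c.+1].

(* [inN i] collects the elements of degree at least [i] for the grading in which
   [m p] has degree [- 2 o p - 1] ([- 2 o p] for [p] in [lev]) and [y] has
   degree 4; [gram_deg] says that the form is compatible with it. *)
Definition inN i X := inH X /\ forall p q j,
  (2 * (o p + o q) + ~~ lev p + ~~ lev q < 4 * j.+1 + i)%N -> cf X p q j = 0.

Lemma inN_inH i X : inN i X -> inH X. Proof. by case. Qed.

Lemma inH_inN0 X : inH X -> inN 0 X.
Proof.
by move=> hX; split=> // p q j lt; apply: cf_out => //; move: lt; lia.
Qed.

Lemma inN_le i j X : (i <= j)%N -> inN j X -> inN i X.
Proof. by move=> le_ij [hX X0]; split=> // p q l lt; apply: X0; lia. Qed.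

Lemma inNZD i c X Y : inN i X -> inN i Y -> inN i (c *: X + Y).
Proof.
move=> [hX X0] [hY Y0]; split=> [|p q j lt]; first exact: inHZD.
by rewrite cfZD X0 // Y0 // mulr0 addr0.
Qed.

Lemma inN_0 i : inN i 0.
Proof. by split=> [|p q j _]; [apply: inH0|rewrite cf0]. Qed.

Lemma inND i X Y : inN i X -> inN i Y -> inN i (X + Y).
Proof. by rewrite -{2}[X]scale1r; apply: inNZD. Qed.

Lemma inNN i X : inN i X -> inN i (- X).
Proof. by move=> hX; rewrite -scaleN1r -[_ *: X]addr0; apply: inNZD (inN_0 _). Qed.

Lemma inNB i X Y : inN i X -> inN i Y -> inN i (X - Y).
Proof. by move=> hX hY; apply: inND hX (inNN hY). Qed.

(** For a nonzero term of [cf_comp], the degree bounds on the coefficient of [X], on that of [Y] and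
    on the Gram entry add up to the bound for the product. *)
Lemma inN_comp a b X Y : inN a X -> inN b Y -> inN (a + b) (X \o Y)%VF.
Proof.
move=> [hX X0] [hY Y0]; split=> [|p q j lt]; first exact: inHM.
rewrite cf_comp // big1 // => s _; rewrite big1 // => i _; rewrite big1 // => r _.
rewrite big1 // => c _.
have [->|/gram_deg dG] := eqVneq (gram s r ((o s).-1 - i + (j + ((o r).-1 - c)))) 0.
  by rewrite mulr0.
have [lt_Y|ge_Y] := ltnP (2 * (o p + o r) + ~~ lev p + ~~ lev r) (4 * c.+1 + b).
  by rewrite Y0 // !mul0r.
have [lt_X|ge_X] := ltnP (2 * (o s + o q) + ~~ lev s + ~~ lev q) (4 * i.+1 + a).
  by rewrite X0 // mulr0 mul0r.
move: (ltn_ord i) (ltn_ord c) dG ge_X ge_Y lt.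
by case: (lev p) (lev q) (lev s) (lev r) => [] [] [] [] /=; lia.
Qed.

Lemma inN_sg i X : inN i X -> inN i (sg X).
Proof.
move=> [hX X0]; split=> [|p q j lt]; first exact: inH_Ar.
by rewrite cf_sg // X0 ?oppr0 //; lia.
Qed.

(** No coefficient has degree above [4 * ord_bound + 2]: twice the sum of two orders, plus one unit
    for each shifted generator. Hence the length [4 * ord_bound + 3] of the iterations below. *)
Lemma inN_big i X : (4 * ord_bound + 2 < i)%N -> inN i X -> X = 0.
Proof.
move=> lt_i [hX X0]; apply: (cf_inj hX inH0) => p q j.
rewrite cf0 X0 //; have := leq_bigmax (F := o) p; have := leq_bigmax (F := o) q.
rewrite -/ord_bound; lia.
Qed.

(** Among the exponents [j < minn (o p) (o q)], where every degree is nonnegative, these are exactly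
    the positions of degree 0. *)
Definition levc p q j := [&& lev p, lev q, o p == o q & j.+1 == o p].

(* The degree 0 part. *)
Definition lpart X : 'End(W) := Ar (fun p q j => if levc p q j then cf X p q j else 0).

Lemma levcC p q j : levc p q j = levc q p j.
Proof.
rewrite /levc (andbCA (lev p)) eq_sym.
by case: eqP => [->|]; rewrite ?andbF.
Qed.

Lemma inH_lpart X : inH (lpart X). Proof. exact: inH_Ar. Qed.

Lemma cf_lpart X p q j : inH X ->
  cf (lpart X) p q j = if levc p q j then cf X p q j else 0.
Proof.
move=> hX; rewrite cf_Ar; case: ltnP => // le_j; case: ifP => // _.
by rewrite cf_out.
Qed.

Lemma lpartZD c X Y : lpart (c *: X + Y) = c *: lpart X + lpart Y.
Proof.
rewrite /lpart -ArZD; apply: eq_Ar => p q j.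
by case: ifP => _; rewrite ?cfZD // mulr0 addr0.
Qed.

Lemma lpartD X Y : lpart (X + Y) = lpart X + lpart Y.
Proof. by rewrite -[X]scale1r lpartZD !scale1r. Qed.

Lemma lpart0 : lpart 0 = 0.
Proof.
by have := lpartZD (-1) 0 0; rewrite scaler0 addr0 scaleN1r addNr.
Qed.

Lemma lpartN X : lpart (- X) = - lpart X.
Proof. by rewrite -scaleN1r -[_ *: X]addr0 lpartZD lpart0 addr0 scaleN1r. Qed.

Lemma lpart_id X : inH X -> lpart (lpart X) = lpart X.
Proof.
move=> hX; apply: (cf_inj (inH_Ar _) (inH_Ar _)).
by move=> p q j; rewrite (cf_lpart _ _ _ (inH_lpart X)) (cf_lpart _ _ _ hX); case: (levc p q j).
Qed.

Lemma lpart_sg X : inH X -> lpart (sg X) = sg (lpart X).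
Proof.
move=> hX; apply: (cf_inj (inH_Ar _) (inH_Ar _)).
move=> p q j; rewrite (cf_lpart _ _ _ (inH_sg X)) (cf_sg _ _ _ hX).
rewrite (cf_sg _ _ _ (inH_lpart X)) (cf_lpart _ _ _ hX) levcC.
by case: ifP; rewrite ?oppr0.
Qed.

(** As no degree is negative, a degree 0 coefficient of the product only receives products of degree
    0 coefficients, by [gram_deg]. Conversely [gram_lev] prevents the product of two degree 0 parts
    from leaving the Levi positions. *)
Lemma lpartM X Y : inH X -> inH Y -> lpart (X \o Y)%VF = (lpart X \o lpart Y)%VF.
Proof.
move=> hX hY; have hXY := inHM hX hY.
apply: (cf_inj (inH_lpart _) (inHM (inH_lpart _) (inH_lpart _))) => p q j.
rewrite cf_lpart // (cf_comp _ _ _ hX hY) (cf_comp _ _ _ (inH_lpart X) (inH_lpart Y)).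
case: ifP => [lev_pq|lev_pq]; last first.
  rewrite big1 // => s _; rewrite big1 // => i _; rewrite big1 // => r _.
  rewrite big1 // => c _; rewrite (cf_lpart _ _ _ hX) (cf_lpart _ _ _ hY).
  case: ifP => [|_]; last by rewrite !mul0r.
  case: ifP => [|_]; last by rewrite mulr0 mul0r.
  have [->|/gram_lev dG] := eqVneq (gram s r ((o s).-1 - i + (j + ((o r).-1 - c)))) 0.
    by rewrite !mulr0.
  move=> /and4P[Ls Lq /eqP sq /eqP i1] /and4P[Lp Lr /eqP pr /eqP c1].
  have [_ rs ds] := dG Ls.
  suff: levc p q j by rewrite lev_pq.
  by rewrite /levc Lp Lq /=; lia.
apply: eq_bigr => s _; apply: eq_bigr => i _; apply: eq_bigr => r _.
apply: eq_bigr => c _; rewrite (cf_lpart _ _ _ hX) (cf_lpart _ _ _ hY).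
have [->|/gram_deg dG] := eqVneq (gram s r ((o s).-1 - i + (j + ((o r).-1 - c)))) 0.
  by rewrite !mulr0.
move: lev_pq => /and4P[Lp Lq /eqP pq /eqP j1].
have := ltn_ord c; rewrite leq_min => /andP[cp cr].
have [le_i|lt_i] := leqP (minn (o s) (o q)) i.
  by rewrite (cf_out hX le_i) if_same !mulr0.
move: lt_i; rewrite leq_min => /andP[si qi].
have -> : levc p r c.
  rewrite /levc; move: dG Lp Lq.
  by case: (lev p) (lev q) (lev s) (lev r) => [] [] [] [] //=; lia.
have -> // : levc s q i.
rewrite /levc; move: dG Lp Lq.
by case: (lev p) (lev q) (lev s) (lev r) => [] [] [] [] //=; lia.
Qed.

Lemma inN1P X : inN 1 X <-> inH X /\ lpart X = 0.
Proof.
split=> [[hX X0]|[hX X0]]; split=> //.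
  apply: (cf_inj (inH_Ar _) inH0) => p q j; rewrite cf_lpart // cf0.
  case: ifP => // /and4P[Lp Lq /eqP pq /eqP j1]; apply: X0.
  by rewrite Lp Lq /=; lia.
move=> p q j lt; have := cf_lpart p q j hX; rewrite X0 cf0.
have [le_j|] := leqP (minn (o p) (o q)) j; first by rewrite cf_out.
rewrite leq_min => /andP[jp jq]; case: ifP => [_ <- //|/negP[]].
rewrite /levc; move: lt.
by case: (lev p) (lev q) => [] [] //=; lia.
Qed.

(** * Linearising the equation of the group *)

Definition tri X : 'End(W) :=
  Ar (fun p q j => if (enum_rank p < enum_rank q)%N then cf X p q j else 0).

Lemma inH_tri X : inH (tri X). Proof. exact: inH_Ar. Qed.

Lemma cf_tri X p q j : inH X ->
  cf (tri X) p q j = if (enum_rank p < enum_rank q)%N then cf X p q j else 0.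
Proof.
move=> hX; rewrite cf_Ar; case: ltnP => // le_j; case: ifP => // _.
by rewrite cf_out.
Qed.

Lemma triZD c X Y : tri (c *: X + Y) = c *: tri X + tri Y.
Proof.
rewrite /tri -ArZD; apply: eq_Ar => p q j.
by case: ifP => _; rewrite ?cfZD // mulr0 addr0.
Qed.

Lemma inN_tri i X : inN i X -> inN i (tri X).
Proof.
move=> [hX X0]; split=> [|p q j lt]; first exact: inH_Ar.
by rewrite cf_tri //; case: ifP => // _; apply: X0.
Qed.

(* An alternating element is recovered from its strictly upper triangular part,
   whatever the characteristic. *)
Lemma tri_alt X : inH X ->
  tri (sg X \o X)%VF + sg (tri (sg X \o X)%VF) = (sg X \o X)%VF.
Proof.
move=> hX; have hXX := inHM (inH_sg X) hX.
apply: (cf_inj (inHD (inH_Ar _) (inH_Ar _)) hXX) => p q j.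
rewrite cfD (cf_sg _ _ _ (inH_tri _)) !(cf_tri _ _ _ hXX).
have E p' q' : cf (sg X \o X)%VF p' q' j = omega (ypow j (X (m p'))) (X (m q')).
  by rewrite /cf comp_lfunE om_sg // (inH_ypow _ _ hX).
case: ltngtP => [_|_|/val_inj/enum_rank_inj ->]; rewrite ?oppr0 ?addr0 ?add0r //.
  by rewrite !E [in RHS]omC om_ypow.
(* On the diagonal both triangular parts are 0, so the coefficient itself must vanish: it is
   [omega (ypow j u) u] with [u = X (m p)]. *)
by rewrite E om_ypow_alt.
Qed.

Definition quad X : 'End(W) := tri (sg X \o X)%VF.

Lemma inN_quad i X : inN i X -> inN i (quad X).
Proof.
move=> NX; apply/inN_tri/(inN_le (j := i + i)); first exact: leq_addr.
exact: inN_comp (inN_sg NX) NX.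
Qed.

Lemma quadB X Y : quad X - quad Y =
  tri ((sg (X - Y) \o X)%VF + (sg Y \o (X - Y))%VF).
Proof.
rewrite /quad -scaleN1r addrC -triZD; congr tri.
rewrite scaleN1r sgD sgN comp_lfunDl comp_lfunDr comp_lfunNl comp_lfunNr.
by rewrite addrA subrK addrC.
Qed.

(** The difference of two quadratic terms always keeps one factor [X] or [Y] of positive degree, so
    [quad] contracts the filtration; uniqueness and existence of solutions both rest on this. *)
Lemma inN_quadB i X Y : inN 1 X -> inN 1 Y -> inN i (X - Y) ->
  inN i.+1 (quad X - quad Y).
Proof.
move=> NX NY NXY; rewrite quadB; apply/inN_tri/inND.
  by rewrite -addn1; apply: inN_comp (inN_sg NXY) NX.
by rewrite -add1n; apply: inN_comp (inN_sg NY) NXY.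
Qed.

Lemma quad_inj X Y : inN 1 X -> inN 1 Y -> X + quad X = Y + quad Y -> X = Y.
Proof.
move=> NX NY E; apply/eqP; rewrite -subr_eq0; apply/eqP.
apply: (@inN_big (4 * ord_bound + 3)); first by lia.
have {}E : X - Y = - (quad X - quad Y).
  by apply/eqP; rewrite -subr_eq0 opprK addrACA -opprD E subrr.
elim: (_ + 3)%N => [|i IHi]; first exact: inH_inN0 (inN_inH (inNB NX NY)).
by rewrite E; apply/inNN/inN_quadB.
Qed.

(* The solution of [X + quad X = z]; the iteration gains one degree per step. *)
Fixpoint qiter z n : 'End(W) := if n is n'.+1 then z - quad (qiter z n') else 0.

Definition qsol z := qiter z (4 * ord_bound + 3).

Lemma inN_qiter z n : inN 1 z -> inN 1 (qiter z n).
Proof.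
move=> Nz; elim: n => [|n IHn] /=; first exact: inN_0.
exact: inNB Nz (inN_quad IHn).
Qed.

Lemma qsolE z : inN 1 z -> qsol z + quad (qsol z) = z.
Proof.
move=> Nz; suff E : qiter z (4 * ord_bound + 3).+1 = qsol z.
  by rewrite -{1}E /= subrK.
apply/eqP; rewrite -subr_eq0; apply/eqP.
apply: (@inN_big (4 * ord_bound + 3)); first by lia.
rewrite /qsol; elim: (_ + 3)%N => [|n IHn].
  exact: inH_inN0 (inN_inH (inNB (inN_qiter _ Nz) (inN_qiter _ Nz))).
have -> : qiter z n.+2 - qiter z n.+1 = - (quad (qiter z n.+1) - quad (qiter z n)).
  by rewrite /= [LHS]addrC !opprB addrA subrK.
by apply/inNN/inN_quadB => //; apply: inN_qiter.
Qed.

Lemma quad_adj X : inH X ->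
  sg (X + quad X) + (X + quad X) = sg X + X + (sg X \o X)%VF.
Proof.
move=> hX; rewrite sgD -(tri_alt hX) -/(quad X).
by rewrite addrACA; congr (_ + _); rewrite addrC.
Qed.

Lemma Sp1_quadP X : inH X ->
  Sp omega (\1 + X)%VF <-> sg (X + quad X) = - (X + quad X).
Proof.
move=> hX; rewrite Sp1P // -quad_adj //.
by split=> [/eqP|->]; [rewrite addr_eq0 => /eqP|rewrite addNr].
Qed.

(** * The stabiliser and its two factors *)

Local Notation stab := (Sp_stab omega (w, y)).

Lemma Sp_ker g : Sp omega g -> lker g == 0%VS.
Proof.
move=> Sg; apply/lker0P => a b eq_ab; apply/eqP; rewrite -subr_eq0; apply/eqP.
apply: om_nondeg => c; rewrite -Sg linearB /= eq_ab subrr; exact: linear0l.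
Qed.

Lemma stabP g : stab g <-> Sp omega g /\ inH (g - \1)%VF.
Proof.
have D u : (g - \1)%VF u = g u - u by rewrite add_lfunE opp_lfunE id_lfunE.
split=> [[Sg [gw gy]]|[Sg [Hy Hw wH]]].
  have gyC u : g (y u) = y (g u).
    by rewrite -{2}gy !comp_lfunE lker0_lfunK ?Sp_ker.
  split=> //; split=> [u||u]; rewrite !D.
  - by rewrite gyC linearB.
  - by rewrite gw subrr.
  - by rewrite linearBl /= -{1}gw Sg subrr.
split=> //; rewrite /Sp_act /=; congr pair.
  by apply/eqP; rewrite -subr_eq0 -D Hw.
apply/lfunP => u; rewrite !comp_lfunE.
have gy v : g (y v) = y (g v).
  have := Hy v; rewrite !D linearB => /eqP; rewrite -subr_eq0 opprB addrA subrK.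
  by rewrite subr_eq0 => /eqP.
by rewrite gy lker0_lfunVK ?Sp_ker.
Qed.

Lemma Sp_comp g h : Sp omega g -> Sp omega h -> Sp omega (g \o h)%VF.
Proof. by move=> Sg Sh a b; rewrite !comp_lfunE Sg Sh. Qed.

Lemma comp1DB (g h : 'End(W)) :
  ((g \o h) - \1 = (g - \1) + (h - \1) + ((g - \1) \o (h - \1)))%VF.
Proof.
apply/lfunP => u; rewrite !(add_lfunE, opp_lfunE, comp_lfunE, id_lfunE) linearB /=.
by rewrite [RHS]addrC [(_ - u + _)]addrC addrA subrK addrA subrK.
Qed.

Lemma inH_comp1 g h : inH (g - \1)%VF -> inH (h - \1)%VF -> inH ((g \o h) - \1)%VF.
Proof.
by move=> hg hh; rewrite comp1DB; apply: inHD (inHM _ _); first exact: inHD.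
Qed.

Lemma inH_sub11 : inH (\1 - \1)%VF. Proof. by rewrite subrr; apply: inH0. Qed.

Lemma stab_comp g h : stab g -> stab h -> stab (g \o h)%VF.
Proof.
move=> /stabP[Sg Hg] /stabP[Sh Hh]; apply/stabP; split; first exact: Sp_comp.
exact: inH_comp1.
Qed.

(** The adjoint of [g], hence its inverse on the stabiliser; being affine in [g], it makes inversion
    a polynomial map. *)
Definition ginv g : 'End(W) := (\1 + sg (g - \1))%VF.

Lemma add1BK (g : 'End(W)) : (\1 + (g - \1))%VF = g.
Proof. by rewrite addrC subrK. Qed.

Lemma add1KB (X : 'End(W)) : (\1 + X - \1)%VF = X :> 'End(W).
Proof. by rewrite addrC addKr. Qed.

Lemma ginv_compl g : stab g -> (ginv g \o g = \1)%VF.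
Proof.
move=> /stabP[Sg Hg]; rewrite /ginv -{2}(add1BK g).
rewrite -(add1BK g) in Sg; move/(Sp1P Hg): Sg.
set D := (g - \1)%VF => S0.
rewrite comp_lfunDl comp_lfunDr !comp_lfun1l comp_lfunDr comp_lfun1r.
by rewrite -addrA (addrA D) (addrC D) S0 addr0.
Qed.

Lemma comp1C (f g : 'End(W)) : (f \o g = \1)%VF -> (g \o f = \1)%VF.
Proof.
move=> fg; have kg : lker g == 0%VS.
  apply/lker0P => a b eq_ab.
  by rewrite -[a](id_lfunE) -[b](id_lfunE) -fg !comp_lfunE eq_ab.
by rewrite -[f]comp_lfun1r -(lker0_compfV kg) (comp_lfunA f) fg comp_lfun1l lker0_compfV.
Qed.

Lemma ginv_compr g : stab g -> (g \o ginv g = \1)%VF.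
Proof. by move=> /ginv_compl/comp1C. Qed.

Lemma ginvE g : stab g -> (g^-1)%VF = ginv g.
Proof.
move=> Gg; have [Sg _] := Gg.
by rewrite -[RHS](lker0_compKf (Sp_ker Sg)) ginv_compr // comp_lfun1r.
Qed.

Lemma stab_ginv g : stab g -> stab (ginv g).
Proof.
move=> Gg; have /stabP[Sg Hg] := Gg; apply/stabP; split=> [a b|].
  by rewrite -Sg -!comp_lfunE ginv_compr // !id_lfunE.
by rewrite add1KB; apply: inH_sg.
Qed.

Definition lmor g : 'End(W) := (\1 + lpart (g - \1))%VF.

Lemma lmorM g h : inH (g - \1)%VF -> inH (h - \1)%VF ->
  lmor (g \o h)%VF = (lmor g \o lmor h)%VF.
Proof.
move=> hg hh; rewrite /lmor comp1DB lpartD lpartD lpartM //.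
rewrite comp_lfunDl comp_lfunDr !comp_lfun1l comp_lfunDr !comp_lfun1r -!addrA.
congr (_ + _); by rewrite addrCA !addrA [X in X + _]addrC.
Qed.

Lemma lmor1 : lmor \1%VF = \1%VF.
Proof. by rewrite /lmor subrr lpart0 addr0. Qed.

Lemma stab_lmor g : stab g -> stab (lmor g).
Proof.
move=> /stabP[Sg Hg]; apply/stabP; split; last by rewrite add1KB; apply: inH_lpart.
apply/Sp1P; first exact: inH_lpart.
rewrite -lpart_sg // -lpartM ?inH_sg //; last exact: inH_sg.
rewrite -!lpartD -[RHS]lpart0; congr lpart.
by apply/Sp1P; rewrite ?add1BK.
Qed.

Lemma lmor_id g : inH (g - \1)%VF -> lmor (lmor g) = lmor g.
Proof. by move=> hg; rewrite {1}/lmor add1KB lpart_id. Qed.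

(** Kernel and image of the idempotent endomorphism [lmor] of the stabiliser. *)
Definition Ugrp g := stab g /\ lmor g = \1%VF.
Definition Lgrp g := stab g /\ lmor g = g.

Lemma stab_inH g : stab g -> inH (g - \1)%VF. Proof. by case/stabP. Qed.

Lemma stab1 : stab \1%VF.
Proof. by apply/stabP; split=> [a b|]; [rewrite !id_lfunE|apply: inH_sub11]. Qed.

Lemma lmor_ginv g : stab g -> (lmor g \o lmor (ginv g) = \1)%VF.
Proof.
by move=> Gg; rewrite -lmorM ?ginv_compr ?lmor1 //; apply: stab_inH => //; apply: stab_ginv.
Qed.

Lemma Ugrp_comp g h : Ugrp g -> Ugrp h -> Ugrp (g \o h)%VF.
Proof.
move=> [Gg lg] [Gh lh]; split; first exact: stab_comp.
by rewrite lmorM ?lg ?lh ?comp_lfun1l //; apply: stab_inH.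
Qed.

Lemma Lgrp_comp g h : Lgrp g -> Lgrp h -> Lgrp (g \o h)%VF.
Proof.
move=> [Gg lg] [Gh lh]; split; first exact: stab_comp.
by rewrite lmorM ?lg ?lh //; apply: stab_inH.
Qed.

Lemma Ugrp_ginv g : Ugrp g -> Ugrp (ginv g).
Proof.
move=> [Gg lg]; split; first exact: stab_ginv.
by have := lmor_ginv Gg; rewrite lg comp_lfun1l.
Qed.

Lemma Lgrp_ginv g : Lgrp g -> Lgrp (ginv g).
Proof.
move=> [Gg lg]; split; first exact: stab_ginv.
have := lmor_ginv Gg; rewrite lg => E.
by rewrite -[lmor _]comp_lfun1l -(ginv_compl Gg) -comp_lfunA E comp_lfun1r.
Qed.

(** * Closedness and polynomiality *)

Lemma sg_linear : linear sg. Proof. by move=> c X Y; apply: sgZD. Qed.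
Lemma lpart_linear : linear lpart. Proof. by move=> c X Y; apply: lpartZD. Qed.
Lemma tri_linear : linear tri. Proof. by move=> c X Y; apply: triZD. Qed.

Lemma Ar_cf_linear : linear (fun X => Ar (cf X)).
Proof. by move=> c X Y; rewrite -ArZD; apply: eq_Ar => p q j; rewrite cfZD. Qed.

Lemma polymap_sub1 : polymap (fun g : 'End(W) => g - \1)%VF.
Proof. exact: polymapB (polymap_lin idfun) (polymap_cst _ _). Qed.

Lemma polymap_lmor : polymap lmor.
Proof.
apply: polymapD (polymap_cst _ _) _.
exact: (polymap_comp polymap_sub1 (polymap_linear lpart_linear)).
Qed.

Lemma polymap_ginv : polymap ginv.
Proof.
apply: polymapD (polymap_cst _ _) _.
exact: (polymap_comp polymap_sub1 (polymap_linear sg_linear)).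
Qed.

Lemma polymap_quad : polymap quad.
Proof.
apply: (polymap_comp _ (polymap_linear tri_linear)).
exact: polymap_comp_lfun (polymap_linear sg_linear) (polymap_lin idfun).
Qed.

Lemma zariski_closed_eq (X Y : vectType k) (f g : X -> Y) :
  polymap f -> polymap g -> zariski_closed (fun x => f x = g x).
Proof.
move=> fP gP; apply: (@eq_zariski_closed _ _ (fun x => forall _ : unit, f x - g x = 0)).
  move=> x; split=> [/(_ tt)/eqP|-> _]; rewrite ?subrr //.
  by rewrite subr_eq0 => /eqP.
by apply: zariski_closed_zeros => _; apply: polymapB.
Qed.

Lemma zariski_closed_stab : zariski_closed stab.
Proof.
pose E g := (sg (g - \1) + (g - \1) + (sg (g - \1) \o (g - \1)))%VF.
(* Membership in [inH] becomes the linear equation [Ar (cf X) = X]. *)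
apply: (@eq_zariski_closed _ _ (fun g => Ar (cf (g - \1)%VF) = (g - \1)%VF /\ E g = 0)).
  move=> g; split=> [[hg Eg]|/stabP[Sg Hg]].
    have Hg : inH (g - \1)%VF by rewrite -hg; apply: inH_Ar.
    by apply/stabP; split=> //; rewrite -(add1BK g); apply/Sp1P.
  by split; [apply: Ar_cf|apply/Sp1P; rewrite ?add1BK].
have P1 := polymap_sub1; have P2 := polymap_comp P1 (polymap_linear sg_linear).
apply: zariski_closedI; apply: zariski_closed_eq => //.
- exact: (polymap_comp P1 (polymap_linear Ar_cf_linear)).
- by apply: polymapD; [apply: polymapD|apply: polymap_comp_lfun].
- exact: polymap_cst.
Qed.

Lemma closed_subgroup_Ugrp : closed_subgroup Ugrp.
Proof.
split.
- apply: zariski_closedI; first exact: zariski_closed_stab.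
  exact: zariski_closed_eq polymap_lmor (polymap_cst _ _).
- by split; [apply: stab1|apply: lmor1].
- exact: Ugrp_comp.
- move=> g Ug; exists (ginv g); first exact: Ugrp_ginv.
  by case: Ug => Gg _; rewrite ginv_compl ?ginv_compr.
Qed.

Lemma closed_subgroup_Lgrp : closed_subgroup Lgrp.
Proof.
split.
- apply: zariski_closedI; first exact: zariski_closed_stab.
  exact: zariski_closed_eq polymap_lmor (polymap_lin idfun).
- by split; [apply: stab1|apply: lmor1].
- exact: Lgrp_comp.
- move=> g Ug; exists (ginv g); first exact: Lgrp_ginv.
  by case: Ug => Gg _; rewrite ginv_compl ?ginv_compr.
Qed.

Lemma Lgrp_lmor g : stab g -> Lgrp (lmor g).
Proof. by move=> Gg; split; [apply: stab_lmor|apply/lmor_id/stab_inH]. Qed.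

Lemma semidirect_stab : alg_semidirect_product stab Ugrp Lgrp.
Proof.
split; first by split; [apply: closed_subgroup_Ugrp|apply: closed_subgroup_Lgrp].
- by split=> g [].
- move=> g u Gg [Gu lu]; rewrite ginvE //.
  have Ggu := stab_comp Gg Gu; have Gi := stab_ginv Gg.
  split; first exact: stab_comp.
  rewrite lmorM ?lmorM ?lu ?comp_lfun1r ?lmor_ginv //; exact: stab_inH.
- split; first apply: morphism_of_polymap.
  + apply: polymap_comp_lfun.
      exact: (polymap_lin (fst : {linear ('End(W) * 'End(W))%type -> 'End(W)})).
    exact: (polymap_lin (snd : {linear ('End(W) * 'End(W))%type -> 'End(W)})).
  + by move=> [u l] [[Gu _] [Gl _]]; apply: stab_comp.
  (* The factor in [Lgrp] is read by [lmor], and dividing by it leaves an element of its kernel. *)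
  exists (fun g => ((g \o ginv (lmor g))%VF, lmor g)); split.
  + apply: morphism_of_polymap.
      apply: polymap_pair polymap_lmor; apply: polymap_comp_lfun (polymap_lin idfun) _.
      exact: (polymap_comp polymap_lmor polymap_ginv).
    move=> g Gg; have Ll := Lgrp_lmor Gg; split=> //=.
    have Li := Lgrp_ginv Ll; have [Gi li] := Li; have [Gl _] := Ll.
    split; first exact: stab_comp.
    by rewrite lmorM ?li ?ginv_compr //; apply: stab_inH.
  + move=> [u l] /= [[Gu lu] [Gl ll]].
    have -> : lmor (u \o l)%VF = l by rewrite lmorM ?lu ?ll ?comp_lfun1l //; apply: stab_inH.
    by rewrite -comp_lfunA ginv_compr // comp_lfun1r.
  + move=> g Gg /=; rewrite -comp_lfunA ginv_compl ?comp_lfun1r //.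
    by have [] := Lgrp_lmor Gg.
Qed.

Lemma Ugrp_inN g : Ugrp g -> inN 1 (g - \1)%VF.
Proof.
move=> [/stab_inH Hg lg]; apply/inN1P; split=> //.
by rewrite -(add1KB (lpart _)) -/(lmor g) lg subrr.
Qed.

Lemma unipotent_Ugrp : unipotent Ugrp.
Proof.
move=> g /Ugrp_inN Ng; exists (4 * ord_bound + 3)%N => a.
pose X n : 'End(W) := iter n (fun f => ((g - \1) \o f)%VF) \1%VF.
have XE n : iter n (fun b => g b - b) a = X n a.
  elim: n => [|n IHn] /=; first by rewrite id_lfunE.
  by rewrite IHn comp_lfunE add_lfunE opp_lfunE id_lfunE.
rewrite XE; suff -> : X (4 * ord_bound + 3)%N = 0 by rewrite zero_lfunE.
apply: (@inN_big (4 * ord_bound + 3)); first by lia.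
(* The induction starts at the first power, as the identity is in general not in [inH]. *)
rewrite addnS; elim: (4 * ord_bound + 2)%N => [|n IHn].
  by rewrite /X /= comp_lfun1r.
by rewrite -[n.+2]add1n; apply: inN_comp Ng IHn.
Qed.

(** * The unipotent factor as an affine space *)

Definition non_levi p q j := ~~ levc p q j.

Lemma non_leviC p q j : non_levi p q j = non_levi q p j.
Proof. by rewrite /non_levi levcC. Qed.

Lemma inN_chart_inv r : inN 1 (chart_inv (g := non_levi) r).
Proof.
apply/inN1P; split; first exact: inH_chart_inv.
apply: (cf_inj (inH_Ar _) inH0) => p q j.
rewrite (cf_lpart _ _ _ (inH_chart_inv r)) cf0; case: ifP => // lv.
by apply: (cf_chart_inv0 non_leviC); rewrite /non_levi lv.
Qed.

Lemma polymap_qsol : polymap qsol.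
Proof.
rewrite /qsol; elim: (_ + 3)%N => [|n IHn] /=; first exact: polymap_cst.
exact: polymapB (polymap_lin idfun) (polymap_comp IHn polymap_quad).
Qed.

Lemma Ugrp_qsol z : inN 1 z -> sg z = - z -> Ugrp (\1 + qsol z)%VF.
Proof.
move=> Nz sgz; have Nq : inN 1 (qsol z) by apply: inN_qiter.
have Hq := inN_inH Nq; split.
  by apply/stabP; rewrite add1KB; split=> //; apply/Sp1_quadP => //; rewrite qsolE.
by rewrite /lmor add1KB; move/inN1P: Nq => [_ ->]; rewrite addr0.
Qed.

Lemma Ugrp_affine : isomorphic_varieties Ugrp (@affine_space k (chart_dim non_levi)).
Proof.
exists (fun u => chart non_levi ((u - \1)%VF + quad (u - \1)%VF)); split.
  apply: morphism_of_polymap => //.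
  apply: (polymap_comp _ (polymap_linear (chart_linear non_levi))).
  exact: polymapD polymap_sub1 (polymap_comp polymap_sub1 polymap_quad).
exists (fun r => (\1 + qsol (chart_inv r))%VF); split.
- apply: morphism_of_polymap => [|r _].
    apply: polymapD (polymap_cst _ _) _.
    exact: (polymap_comp (polymap_linear (chart_inv_linear (g := non_levi))) polymap_qsol).
  by apply: Ugrp_qsol; [apply: inN_chart_inv|apply: sg_chart_inv].
- move=> u Uu; have Nu := Ugrp_inN Uu; have Hu := inN_inH Nu.
  have Nz := inND Nu (inN_quad Nu).
  rewrite -[RHS]add1BK; congr (_ + _).
  rewrite (chartK non_leviC) //; first 1 last.
  + exact: inN_inH Nz.
  + by apply/Sp1_quadP; rewrite ?add1BK //; case: Uu => /stabP[].
  + move=> p q j; rewrite negbK => lv.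
    move/inN1P: Nz => [Hz lz]; have := cf_lpart p q j Hz.
    by rewrite lv lz cf0.
  by apply: (quad_inj (inN_qiter _ Nz) Nu); rewrite -/(qsol _) qsolE.
- by move=> r _; rewrite add1KB qsolE ?chart_invK //; apply: inN_chart_inv.
Qed.

(** * The Levi factor as a product of symplectic groups *)

Variables (s : nat) (r : 'I_s -> nat) (lv : forall h, 'I_(r h + r h) -> P).
Arguments lv : clear implicits.
Variable (l : 'I_s -> nat).
Hypothesis l_gt0 : forall h, (0 < l h)%N.
Hypothesis l_inj : injective l.
Hypothesis lv_inj : forall h, injective (lv h).
Hypothesis lv_lev : forall h i, lev (lv h i).
Hypothesis levP : forall p, lev p -> exists h i, p = lv h i.
Hypothesis lv_ord : forall h i, o (lv h i) = l h.
Hypothesis gram_lv : forall h i j,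
  gram (lv h i) (lv h j) (l h).-1 = Jmx k (r h) i j.

Lemma levcP p q j : reflect
  (exists h i i', [/\ p = lv h i, q = lv h i' & j = (l h).-1]) (levc p q j).
Proof.
apply: (iffP and4P) => [[Lp Lq /eqP pq /eqP j1]|[h [i [i' [-> -> ->]]]]]; last first.
  by rewrite !lv_lev !lv_ord prednK.
have [h [i pE]] := levP Lp; have [h' [i' qE]] := levP Lq.
have hh' : h' = h by apply: l_inj; rewrite -(lv_ord i) -(lv_ord i') -pE -qE.
subst h'.
by exists h, i, i'; split=> //; rewrite -(lv_ord i) -pE -j1.
Qed.

Lemma levc_lv h i i' : levc (lv h i) (lv h i') (l h).-1.
Proof. by apply/levcP; exists h, i, i'. Qed.

(* The matrix is the transpose of the array of coefficients, which makes
   [sp_of] below the matrix of [1 + X] on top generators. *)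
Definition lmat h X : 'M[k]_(r h + r h) :=
  \matrix_(q, p) cf X (lv h p) (lv h q) (l h).-1.

Lemma lmatD h X Y : lmat h (X + Y) = lmat h X + lmat h Y.
Proof. by apply/matrixP => i j; rewrite !mxE cfD. Qed.

Lemma lmatZD h c X Y : lmat h (c *: X + Y) = c *: lmat h X + lmat h Y.
Proof. by apply/matrixP => i j; rewrite !mxE cfZD. Qed.

Lemma lmat0 h : lmat h 0 = 0.
Proof. by apply/matrixP => i j; rewrite !mxE cf0. Qed.

Lemma lmat_sg h X : inH X -> lmat h (sg X) = - (lmat h X)^T.
Proof. by move=> hX; apply/matrixP => i j; rewrite !mxE cf_sg. Qed.

Lemma lmat_inj X : inH X -> lpart X = X -> (forall h, lmat h X = 0) -> X = 0.
Proof.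
move=> hX lX X0; apply: (cf_inj hX inH0) => p q j; rewrite cf0 -lX cf_lpart //.
case: ifP => // /levcP[h [i [i' [-> -> ->]]]].
by have /matrixP/(_ i' i) := X0 h; rewrite !mxE.
Qed.

Lemma sum_lv h (F : P -> k) : (forall p, (forall i, p <> lv h i) -> F p = 0) ->
  \sum_p F p = \sum_i F (lv h i).
Proof.
move=> F0; rewrite -(big_imset F (in2W (@lv_inj h))) /= big_mkcond [RHS]big_mkcond.
apply: eq_bigr => p _; case: imsetP => // np.
by apply: F0 => i pE; case: np; exists i.
Qed.

(** In [cf_comp] only generators of block [h] survive, with both exponents equal to [(l h).-1]; the
    Gram entries left are those of [gram_lv]. *)
Lemma lmatM h X Y : inH X -> inH Y -> lpart X = X -> lpart Y = Y ->
  lmat h (X \o Y)%VF = lmat h X *m Jmx k (r h) *m lmat h Y.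
Proof.
move=> hX hY lX lY; apply/matrixP => i' i; rewrite mxE cf_comp //.
have X0 p q j : cf X p q j != 0 -> levc p q j.
  by rewrite -{1}lX cf_lpart //; case: ifP; rewrite ?eqxx.
have Y0 p q j : cf Y p q j != 0 -> levc p q j.
  by rewrite -{1}lY cf_lpart //; case: ifP; rewrite ?eqxx.
have lvh' p j a : levc p (lv h a) j -> j = (l h).-1 /\ exists i, p = lv h i.
  move=> /levcP[h' [i1 [i2 [-> E2 ->]]]].
  have -> : h = h' by apply: l_inj; rewrite -(lv_ord a) E2 lv_ord.
  by split=> //; exists i1.
have l1 : ((l h).-1 < l h)%N by rewrite prednK.
rewrite -mulmxA mxE (sum_lv (h := h)); last first.
  move=> p np; rewrite big1 // => a _; rewrite big1 // => q _; rewrite big1 // => b _.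
  have [->|/X0/lvh'[_ [i1 /np]]] // := eqVneq (cf X p (lv h i') a) 0.
  by rewrite mulr0 mul0r.
apply: eq_bigr => i2 _; rewrite [(_ *m _) _ _]mxE mulr_sumr [lmat h X _ _]mxE.
rewrite (sum_ord_only (j := (l h).-1) (F := fun a => \sum_q
  \sum_(b < minn (o (lv h i)) (o q)) cf Y (lv h i) q b * cf X (lv h i2) (lv h i') a *
   gram (lv h i2) q ((o (lv h i2)).-1 - a + ((l h).-1 + ((o q).-1 - b))))).
  rewrite lv_ord l1 (sum_lv (h := h)); last first.
    move=> q nq; rewrite big1 // => b _.
    have [->|] := eqVneq (cf Y (lv h i) q b) 0; first by rewrite !mul0r.
    by rewrite -[cf Y _ _ _ != 0]/(_) => /Y0; rewrite levcC => /lvh'[_ [i1 /nq]].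
  apply: eq_bigr => i1 _; rewrite [lmat h Y _ _]mxE !lv_ord minnn.
  rewrite (sum_ord_only (j := (l h).-1) (F := fun b => cf Y (lv h i) (lv h i1) b
    * cf X (lv h i2) (lv h i') (l h).-1 *
    gram (lv h i2) (lv h i1) ((l h).-1 - (l h).-1 + ((l h).-1 + ((l h).-1 - b))))).
    by rewrite l1 subnn add0n addn0 gram_lv -mulrA mulrC -mulrA.
  move=> b _ ne_b; have [->|/Y0/lvh'[E _]] := eqVneq (cf Y (lv h i) (lv h i1) b) 0.
    by rewrite !mul0r.
  by rewrite E eqxx in ne_b.
move=> a _ ne_a; rewrite big1 // => q _; rewrite big1 // => b _.
have [->|/X0/lvh'[E _]] := eqVneq (cf X (lv h i2) (lv h i') a) 0.
  by rewrite mulr0 mul0r.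
by rewrite E eqxx in ne_a.
Qed.

Definition lev_arr (D : forall h, 'M[k]_(r h + r h)) : 'End(W) :=
  Ar (fun p q j => \sum_h \sum_i \sum_i'
    if [&& lv h i == p, lv h i' == q & j == (l h).-1] then D h i' i else 0).

Lemma eq_lev_arr D E : (forall h, D h = E h) -> lev_arr D = lev_arr E.
Proof.
move=> DE; apply: eq_Ar => p q j; apply: eq_bigr => h _.
by apply: eq_bigr => i _; apply: eq_bigr => i' _; rewrite DE.
Qed.

Lemma lev_arrZD c D E :
  lev_arr (fun h => c *: D h + E h) = c *: lev_arr D + lev_arr E.
Proof.
rewrite -ArZD; apply: eq_Ar => p q j.
rewrite mulr_sumr -big_split; apply: eq_bigr => h _ /=.
rewrite mulr_sumr -big_split; apply: eq_bigr => i _ /=.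
rewrite mulr_sumr -big_split; apply: eq_bigr => i' _ /=.
by case: ifP; rewrite ?mxE // mulr0 addr0.
Qed.

Lemma inH_lev_arr D : inH (lev_arr D). Proof. exact: inH_Ar. Qed.

Lemma lpart_lev_arr D : lpart (lev_arr D) = lev_arr D.
Proof.
apply: (cf_inj (inH_Ar _) (inH_Ar _)) => p q j.
rewrite (cf_lpart _ _ _ (inH_lev_arr D)); case: ifPn => // nlev.
rewrite cf_Ar big1 ?if_same // => h _; rewrite big1 // => i _; rewrite big1 // => i' _.
case: ifP => // /and3P[/eqP E1 /eqP E2 /eqP E3]; case/negP: nlev.
by rewrite -E1 -E2 E3 levc_lv.
Qed.

Lemma lmat_lev_arr h D : lmat h (lev_arr D) = D h.
Proof.
apply/matrixP => i' i; rewrite mxE cf_Ar !lv_ord minnn prednK // leqnn.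
rewrite (sum_only (i := h)) => [|h' ne_h]; last first.
  rewrite big1 // => a _; rewrite big1 // => b _; case: ifP => // /and3P[/eqP E _ _].
  by case/eqP: ne_h; apply: l_inj; rewrite -(lv_ord a) E lv_ord.
rewrite (sum_only (i := i)) => [|a ne_a]; last first.
  by rewrite big1 // => b _; rewrite (inj_eq (@lv_inj h)) (negPf ne_a).
rewrite (sum_only (i := i')) => [|a ne_a]; first by rewrite !eqxx.
by rewrite !(inj_eq (@lv_inj h)) (negPf ne_a) andbF.
Qed.

(** The factor [J] untwists the product of [lmatM]: for arrays [C] and [D],
    [(J C) (J D) = J (C J D)]. *)
Definition sp_of h X : 'M[k]_(r h + r h) := 1%:M + Jmx k (r h) *m lmat h X.

Lemma sp_ofP h X : inH X -> lpart X = X ->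
  Sp_mx (sp_of h X) <-> lmat h (sg X + X + (sg X \o X)%VF) = 0.
Proof.
move=> hX lX; rewrite !lmatD lmat_sg // lmatM ?lmat_sg ?lpart_sg ?lX //; last exact: inH_sg.
rewrite /Sp_mx /sp_of; set C := lmat h X; set J := Jmx k _.
have -> : (1%:M + J *m C)^T *m J *m (1%:M + J *m C) = J - (- C^T + C + - C^T *m J *m C).
  have AJ : (J *m C)^T *m J = C^T.
    by rewrite trmx_mul Jmx_tr mulmxN mulNmx -mulmxA Jmx_sqr mulmxN mulmx1 opprK.
  rewrite [(_ + _)^T]linearD /= tr_scalar_mx mulmxDl mul1mx AJ.
  rewrite mulmxDl !mulmxDr !mulmx1 mulmxA Jmx_sqr.
  by rewrite !mulNmx mul1mx !opprD !opprK -!mulmxA !addrA [J - C + _]addrAC.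
split=> [/eqP|->]; last by rewrite subr0.
by rewrite -subr_eq0 addrAC subrr add0r oppr_eq0 => /eqP.
Qed.

Definition to_sp g : 'M[k]_(\sum_h (r h + r h)) := \mxdiag_h sp_of h (g - \1)%VF.

(** Here [- Jmx] is the inverse of [Jmx]. Reading only the diagonal blocks gives an affine map
    defined on all matrices. *)
Definition of_sp (A : 'M[k]_(\sum_h (r h + r h))) : 'End(W) :=
  (\1 + lev_arr (fun h => - Jmx k (r h) *m (submxblock A h h - 1%:M)))%VF.

Lemma Lgrp_lpart g : Lgrp g -> lpart (g - \1)%VF = (g - \1)%VF.
Proof. by move=> [_ lg]; rewrite -{2}lg /lmor add1KB. Qed.

Lemma Lgrp_spP X : inH X -> lpart X = X ->
  Lgrp (\1 + X)%VF <-> forall h, Sp_mx (sp_of h X).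
Proof.
move=> hX lX; have hXX := inHM (inH_sg X) hX.
have lmE : lmor (\1 + X)%VF = (\1 + X)%VF by rewrite /lmor add1KB lX.
split=> [[/stabP[/(Sp1P hX) SX _] _] h|SX]; first by apply/sp_ofP; rewrite ?SX ?lmat0.
split=> //; apply/stabP; rewrite add1KB; split=> //; apply/Sp1P => //.
apply: lmat_inj => [||h]; last by apply/sp_ofP.
  exact: inHD (inHD (inH_sg _) hX) hXX.
by rewrite !lpartD lpart_sg // lpartM ?lpart_sg ?lX //; apply: inH_sg.
Qed.

Lemma to_sp_mul g h : Lgrp g -> Lgrp h -> to_sp (g \o h)%VF = to_sp g *m to_sp h.
Proof.
move=> Lg Lh; rewrite /to_sp mul_mxdiag; apply: eq_mxdiag => i.
have [Hg Hh] := (stab_inH Lg.1, stab_inH Lh.1).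
have [lg lh] := (Lgrp_lpart Lg, Lgrp_lpart Lh).
rewrite /sp_of comp1DB; move: (g - \1)%VF (h - \1)%VF => X Y in Hg Hh lg lh *.
by rewrite !lmatD lmatM // !mulmxDr mulmx1 mulmxDl mul1mx !mulmxA -!addrA.
Qed.

Lemma to_spK g : Lgrp g -> of_sp (to_sp g) = g.
Proof.
move=> Lg; rewrite -[RHS]add1BK /of_sp; congr (_ + _); apply/eqP.
have Hg := stab_inH Lg.1.
rewrite -subr_eq0; apply/eqP/lmat_inj => [||h].
- exact: inHB (inH_lev_arr _) Hg.
- by rewrite lpartD lpartN lpart_lev_arr Lgrp_lpart.
rewrite -scaleN1r addrC lmatZD lmat_lev_arr scaleN1r submxblock_diag.
by rewrite /sp_of addrAC subrr add0r mulNmx mulmxA Jmx_sqr mulNmx mul1mx opprK addNr.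
Qed.

Lemma of_spK B : of_sp (\mxdiag_h B h) = (\1 + lev_arr (fun h => - Jmx k (r h) *m (B h - 1%:M)))%VF.
Proof.
by congr (_ + _); apply: eq_lev_arr => h; rewrite submxblock_diag.
Qed.

Lemma sp_of_lev_arr B h :
  sp_of h (lev_arr (fun h => - Jmx k (r h) *m (B h - 1%:M))) = B h.
Proof.
rewrite /sp_of lmat_lev_arr mulNmx mulmxN mulmxA Jmx_sqr mulNmx mul1mx opprK.
by rewrite addrC subrK.
Qed.

Lemma to_sp_linear : linear (fun X => \mxdiag_h (Jmx k (r h) *m lmat h X)).
Proof.
move=> c X Y; rewrite scale_mxdiag -mxdiagD; apply: eq_mxdiag => h.
by rewrite lmatZD mulmxDr scalemxAr.
Qed.

Lemma of_sp_linear :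
  linear (fun A => lev_arr (fun h => - Jmx k (r h) *m submxblock A h h)).
Proof.
move=> c A B; rewrite -lev_arrZD; apply: eq_lev_arr => h.
have -> : submxblock (c *: A + B) h h = c *: submxblock A h h + submxblock B h h.
  by apply/matrixP => i j; rewrite !mxE.
by rewrite mulmxDr scalemxAr.
Qed.

Lemma polymap_to_sp : polymap to_sp.
Proof.
apply: (eq_polymap (f := fun g => \mxdiag_h 1%:M +
   \mxdiag_h (Jmx k (r h) *m lmat h (g - \1)%VF))) => [g|].
  by rewrite -mxdiagD.
apply: polymapD (polymap_cst _ _) _.
exact: (polymap_comp polymap_sub1 (polymap_linear to_sp_linear)).
Qed.

Lemma polymap_of_sp : polymap of_sp.
Proof.
apply: (eq_polymap (f := fun A => (\1 + lev_arr (fun h => Jmx k (r h)))%VF +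
   lev_arr (fun h => - Jmx k (r h) *m submxblock A h h))) => [A|].
  rewrite -addrA; congr (_ + _); rewrite -[lev_arr (fun _ => _)]scale1r -lev_arrZD.
  by apply: eq_lev_arr => h; rewrite scale1r mulmxDr mulmxN mulmx1 opprK addrC.
exact: polymapD (polymap_cst _ _) (polymap_linear of_sp_linear).
Qed.

Lemma Lgrp_Sp_prod :
  isomorphic_alg_groups Lgrp (fun g h => (g \o h)%VF) (@Sp_prod k _ r)
    (fun A B => A *m B).
Proof.
exists to_sp; last exact: to_sp_mul; split.
  apply: morphism_of_polymap polymap_to_sp _ => g Lg.
  exists (fun h => sp_of h (g - \1)%VF) => // h.
  by have [] := Lgrp_spP (stab_inH Lg.1) (Lgrp_lpart Lg); rewrite add1BK => /(_ Lg h).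
exists of_sp; split=> [|g Lg|_ [B SB ->]].
- apply: morphism_of_polymap polymap_of_sp _ => _ [B SB ->].
  rewrite of_spK; apply/Lgrp_spP => [||h]; first exact: inH_lev_arr.
    exact: lpart_lev_arr.
  by rewrite sp_of_lev_arr.
- exact: to_spK.
by rewrite of_spK /to_sp; apply: eq_mxdiag => h; rewrite add1KB sp_of_lev_arr.
Qed.

(** * Splitting the dimension between the two factors *)

Lemma sum_lev (F : P -> nat) : (forall p, ~~ lev p -> F p = 0%N) ->
  (\sum_p F p = \sum_h \sum_i F (lv h i))%N.
Proof.
move=> F0; pose f (x : {h : 'I_s & 'I_(r h + r h)}) := lv (tag x) (tagged x).
have f_inj : injective f.
  move=> [h i] [h' i']; rewrite /f /= => E.
  have hh' : h' = h by apply: l_inj; rewrite -(lv_ord i) -(lv_ord i') E.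
  by subst h'; move/lv_inj: E => ->.
rewrite sig_big_dep /= -(big_imset F (in2W f_inj)) /= big_mkcond [RHS]big_mkcond.
apply: eq_bigr => p _; case: imsetP => // np.
have [/levP[h [i pE]]|/F0 //] := boolP (lev p).
by case: np; exists (Tagged (fun h => 'I_(r h + r h)) i).
Qed.

Lemma levc_lvE h h' i i' j :
  levc (lv h i) (lv h' i') j = (h == h') && (j == (l h).-1).
Proof.
rewrite /levc !lv_lev !lv_ord (inj_eq l_inj) /=; congr (_ && _).
by rewrite -{1}(prednK (l_gt0 h)) eqSS.
Qed.

(** Block [h] has [2 * r h] Levi generators and a single exponent of degree 0; symmetric arrays of
    that size have dimension [2 * r h ^ 2 + r h], that of the Lie algebra of [Sp_(2r)]. *)
Lemma chart_dim_split : (chart_dim non_levi + \sum_h (2 * r h ^ 2 + r h) =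
  chart_dim (fun _ _ _ => true))%N.
Proof.
apply/eqP; rewrite -(eqn_pmul2l (isT : 0 < 2)%N) mulnDr !double_chart_dim //; last first.
  exact: non_leviC.
have S1 : (\sum_p \sum_q \sum_(j < minn (o p) (o q)) levc p q j =
   \sum_h (r h + r h) * (r h + r h))%N.
  rewrite sum_lev => [|p np]; last first.
    by rewrite big1 // => q _; rewrite big1 // => j _; rewrite /levc (negPf np).
  apply: eq_bigr => h _; under eq_bigr => i _.
    rewrite sum_lev => [|q nq]; last first.
      by rewrite big1 // => j _; rewrite /levc (negPf nq) andbF.
    rewrite (sum_only (i := h)) => [|h' ne_h]; last first.
      by rewrite big1 // => i' _; rewrite big1 // => j _; rewrite levc_lvE eq_sym (negPf ne_h).
    under eq_bigr => i' _.
      rewrite (sum_ord_only (j := (l h).-1) (F := fun j => levc (lv h i) (lv h i') j : nat)).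
        rewrite levc_lvE !eqxx !lv_ord minnn prednK // leqnn; over.
      by move=> j _ ne_j; rewrite levc_lvE (negPf ne_j) andbF.
    rewrite sum_nat_const card_ord muln1; over.
  by rewrite sum_nat_const card_ord.
have S2 : (\sum_p \sum_(j < o p) levc p p j = \sum_h (r h + r h))%N.
  rewrite sum_lev => [|p np]; last first.
    by rewrite big1 // => j _; rewrite /levc (negPf np).
  apply: eq_bigr => h _; under eq_bigr => i _.
    rewrite (sum_ord_only (j := (l h).-1) (F := fun j => levc (lv h i) (lv h i) j : nat)).
      rewrite levc_lvE !eqxx lv_ord prednK // leqnn; over.
    by move=> j _ ne_j; rewrite levc_lvE (negPf ne_j) andbF.
  by rewrite sum_nat_const card_ord muln1.
have -> : (2 * \sum_h (2 * r h ^ 2 + r h) =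
    \sum_p \sum_q \sum_(j < minn (o p) (o q)) levc p q j +
    \sum_p \sum_(j < o p) levc p p j)%N.
  rewrite S1 S2 -big_split big_distrr; apply: eq_bigr => h _ /=.
  by rewrite expnS expn1; nia.
rewrite addnACA -!big_split; apply/eqP; apply: eq_bigr => p _ /=; congr (_ + _)%N.
  rewrite -big_split; apply: eq_bigr => q _ /=.
  by rewrite -big_split; apply: eq_bigr => j _ /=; rewrite /non_levi; case: levc.
by rewrite -big_split; apply: eq_bigr => j _ /=; rewrite /non_levi; case: levc.
Qed.

End Frame.

Lemma natr_bool_neq0 (R : pzRingType) (b : bool) : (b%:R : R) != 0 -> b.
Proof. by case: b; rewrite ?eqxx. Qed.

(** * Frames from Jordan bases *)

(* The skew elements of the algebra [inH], for the adjunction of [omega]. *)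
Definition skewH (k : fieldType) (W : vectType k) (omega : {skew_symmetric W})
    (y : 'End(W)) (w : W) (X : 'End(W)) : Prop :=
  inH omega y w X /\ forall a b, omega a (X b) = - omega (X a) b.

(** Expressed by linear coordinates because each frame supplies such a chart; two frames are then
    compared by [has_dim_inj]. *)
Definition has_dim (k : fieldType) (X : vectType k) (A : X -> Prop) (d : nat) : Prop :=
  exists (f : X -> 'rV[k]_d) (g : 'rV[k]_d -> X),
    [/\ linear f, linear g, forall r, A (g r), cancel g f & forall x, A x -> g (f x) = x].

Lemma has_dim_le (k : fieldType) (X : vectType k) (A : X -> Prop) d e :
  has_dim A d -> has_dim A e -> (d <= e)%N.
Proof.
move=> [f [g [fL gL Ag gK _]]] [f' [g' [f'L g'L _ _ f'K]]].
have hL : linear (fun r => f' (g r)) by move=> c u v; rewrite gL f'L.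
pose h : {linear 'rV[k]_d -> 'rV[k]_e} := HB.pack (fun r => f' (g r))
  (GRing.isLinear.Build _ _ _ _ _ hL).
suff /eqP <- : row_free (lin1_mx h) by apply: rank_leq_col.
rewrite -kermx_eq0; apply/eqP/row_matrixP => i; rewrite row0.
have : row i (kermx (lin1_mx h)) *m lin1_mx h = 0 by rewrite -row_mul mulmx_ker row0.
rewrite mul_rV_lin1 /= => E.
have lin0 (U V : lmodType k) (q : U -> V) : linear q -> q 0 = 0.
  by move=> qL; have := qL (-1) 0 0; rewrite scaler0 addr0 scaleN1r addNr.
by rewrite -[LHS]gK -[g _]f'K ?Ag // E (lin0 _ _ _ g'L) (lin0 _ _ _ fL).
Qed.

Lemma has_dim_inj (k : fieldType) (X : vectType k) (A : X -> Prop) d e :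
  has_dim A d -> has_dim A e -> d = e.
Proof. by move=> Ad Ae; apply/eqP; rewrite eqn_leq !(has_dim_le (A := A)). Qed.

Section Rows.
Variables (k : fieldType) (W : vectType k) (omega : {skew_symmetric W}).
Variables (y : 'End(W)) (w : W).
Hypothesis om_nondeg : forall a, (forall b, omega a b = 0) -> a = 0.
Hypothesis om_alt : forall a, omega a a = 0.
Hypothesis om_y : forall a b, omega (y a) b = omega a (y b).
Hypothesis om_y_alt : forall a, omega (y a) a = 0.

Variables (n s : nat) (r : 'I_s -> nat).
Local Notation R := ('I_n + {h : 'I_s & 'I_(r h)})%type.
Variables (M N : nat -> nat) (l : 'I_s -> nat) (a b : R -> W).

Definition row_ord (i : R) : nat :=
  match i with inl c => M c + N c | inr x => l (tag x) end.

Hypothesis a_ord : forall i, ypow y (row_ord i) (a i) = 0.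
Hypothesis b_ord : forall i, ypow y (row_ord i) (b i) = 0.
Hypothesis om_aa : forall c i j, omega (ypow y c (a i)) (a j) = 0.
Hypothesis om_bb : forall c i j, omega (ypow y c (b i)) (b j) = 0.
Hypothesis om_ab : forall c i j,
  omega (ypow y c (a i)) (b j) = ((i == j) && (c.+1 == row_ord i))%:R.
Hypothesis row_span : forall f : 'Hom(W, k^o),
  (forall i c, f (ypow y c (a i)) = 0 /\ f (ypow y c (b i)) = 0) -> forall u, f u = 0.
Hypothesis wE : w = \sum_(c < n) ypow y (N c) (a (inl c)).
Hypothesis M_n : forall c, (n <= c)%N -> M c = 0%N.
Hypothesis M_le : forall c d, (c <= d)%N -> (M d <= M c)%N.
Hypothesis N_le : forall c d, (c <= d < n)%N -> (N d <= N c)%N.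

(** The value 0 past the end lets the dual vector of the last row follow the same formula as the
    others. *)
Definition chain_b c : W := if insub c is Some i then b (inl (i : 'I_n)) else 0.

(* [inl i] stands for the generator [b i], [inr i] for [a i].  In the chain,
   [a c] is replaced by a sum chosen so that [y ^ (N c)] maps it to the first
   [c + 1] terms of [w]; modulo [k[y]w] its order drops to [N c + M c.+1]. *)
Definition frame_order (p : R + R) : nat :=
  match p with
  | inl i => row_ord i
  | inr (inl c) => N c + M c.+1
  | inr (inr x) => l (tag x)
  end.

Definition frame_m (p : R + R) : W :=
  match p with
  | inl i => b i
  | inr (inl c) => \sum_(d < n | (d <= c)%N) ypow y (N d - N c) (a (inl d))
  | inr (inr x) => a (inr x)
  end.

(** On the chain [frame_m] is a partial sum, so its dual is a difference: pairing gives the terms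
    [d = c] and [d = c.+1] with opposite signs, which telescope. The power of [y] aligns the two
    exponents, and the signs come from [omega (b i) (a i)] being opposite to [omega (a i) (b i)]. *)
Definition frame_ms (p : R + R) : W :=
  match p with
  | inl i => a i
  | inr (inl c) => chain_b c.+1 - ypow y (M c - M c.+1) (b (inl c))
  | inr (inr x) => - b (inr x)
  end.

Lemma om_ba c i j :
  omega (ypow y c (b i)) (a j) = - ((i == j) && (c.+1 == row_ord i))%:R.
Proof.
rewrite omC -om_ypow // om_ab eq_sym; congr (- _%:R).
by case: eqP => [->|].
Qed.

Lemma om_chain_b c e (d : 'I_n) :
  omega (ypow y e (chain_b c)) (a (inl d)) = - ((c == d) && (e.+1 == M d + N d)%N)%:R.
Proof.
rewrite /chain_b; case: insubP => [i _ <-|]; last first.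
  rewrite -leqNgt => le_nc; rewrite linear0 linear0l.
  by rewrite gtn_eqF ?oppr0 // (leq_trans (ltn_ord d)).
rewrite om_ba.
have -> : (inl i == inl d :> R) = (i == d) by [].
by rewrite -val_eqE /=; case: eqP => //= ->.
Qed.

Local Notation rgram := (gram omega y frame_ms).

Lemma rows_frame_dual e p q :
  omega (ypow y e (frame_ms p)) (frame_m q) = ((p == q) && (e.+1 == frame_order p))%:R.
Proof.
case: p q => [i|[c|x]] [j|[d|z]] /=.
- by rewrite om_ab.
- by rewrite linear_sumr big1 // => d' _ /=; rewrite -om_ypow // -ypowD om_aa.
- by rewrite om_aa.
- rewrite linearB linearBl /= -ypowD om_bb subr0 /chain_b.
  by case: insubP => [i _ _|_]; rewrite ?om_bb // linear0 linear0l.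
- rewrite linear_sumr /=.
  have -> : (inr (inl c) == inr (inl d) :> R + R) = (c == d) by [].
  have S x Q : \sum_(d' < n | (d' <= d)%N) ((x == d' :> nat) && Q)%:R
      = ((x <= d)%N && Q)%:R :> k.
    rewrite big_mkcond (sum_ord_only (j := x)
      (F := fun i => if (i <= d)%N then ((x == i) && Q)%:R else 0)) => [|i _ ne_i].
      rewrite eqxx /=; case: (leqP x d) => [le_xd|]; last by rewrite if_same.
      by rewrite (leq_ltn_trans le_xd).
    by rewrite eq_sym (negPf ne_i) if_same.
  have E (d' : 'I_n) : (d' <= d)%N ->
      omega (ypow y e (chain_b c.+1 - ypow y (M c - M c.+1) (b (inl c))))
        (ypow y (N d' - N d) (a (inl d'))) =
      ((c == d' :> nat) && (e.+1 == N d + M c.+1)%N)%:R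
       - ((c.+1 == d' :> nat) && (e.+1 == N d + M c.+1)%N)%:R.
    move=> le_d; have leN : (N d <= N d')%N by apply: N_le; rewrite le_d ltn_ord.
    rewrite -om_ypow // -ypowD linearB linearBl /= -ypowD om_chain_b om_ba opprK addrC.
    have -> : (inl c == inl d' :> R) = (c == d' :> nat) by [].
    have leM := M_le (leqnSn c).
    congr (_%:R - _%:R).
      case: eqP => [Ec|] //=; move: leN; rewrite -Ec => leN; congr nat_of_bool.
      by apply/eqP/eqP; lia.
    case: eqP => [Ec|] //=; rewrite -Ec in leN *; congr nat_of_bool.
    by apply/eqP/eqP; lia.
  rewrite (eq_bigr _ E) sumrB !S -val_eqE /=.
  rewrite [(c < d)%N]ltn_neqAle.
  case: (eqVneq (c : nat) d) => [Ecd|_] /=; last by rewrite subrr.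
  by rewrite -Ecd leqnn subr0.
- by rewrite linearB linearBl /= -ypowD om_ba /chain_b; case: insubP => [i _ _|_];
    rewrite ?om_ba ?linear0 ?linear0l /= ?subrr // oppr0 subrr.
- by rewrite linearN linearNl /= om_bb oppr0.
- rewrite linearN linearNl /= linear_sumr big1 ?oppr0 // => d' _ /=.
  by rewrite -om_ypow // -ypowD om_ba oppr0.
- by rewrite linearN linearNl /= om_ba opprK.
Qed.

Lemma rows_frame_w e p : omega (ypow y e (frame_ms p)) w = 0.
Proof.
rewrite wE linear_sumr; case: p => [i|[c|x]] /=.
- by rewrite big1 // => d _ /=; rewrite -om_ypow // -ypowD om_aa.
- have E (d : 'I_n) : true -> omega (ypow y e (chain_b c.+1 - ypow y (M c - M c.+1) (b (inl c))))
        (ypow y (N d) (a (inl d))) =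
      ((c == d :> nat) && (e.+1 == M c.+1)%N)%:R
       - ((c.+1 == d :> nat) && (e.+1 == M c.+1)%N)%:R.
    move=> _; rewrite -om_ypow // -ypowD linearB linearBl /= -ypowD om_chain_b om_ba opprK addrC.
    have -> : (inl c == inl d :> R) = (c == d :> nat) by [].
    have leM := M_le (leqnSn c).
    congr (_%:R - _%:R).
      case: eqP => [Ec|] //=; rewrite -Ec; congr nat_of_bool.
      by apply/eqP/eqP; lia.
    case: eqP => [Ec|] //=; rewrite -Ec; congr nat_of_bool.
    by apply/eqP/eqP; lia.
  rewrite (eq_bigr _ E) sumrB.
  have S x Q : \sum_(d < n) ((x == d :> nat) && Q)%:R = ((x < n)%N && Q)%:R :> k.
    rewrite (sum_ord_only (j := x) (F := fun i => ((x == i) && Q)%:R)) => [|i _ ne_i].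
      by rewrite eqxx /=; case: ifP.
    by rewrite eq_sym (negPf ne_i).
  (* The two terms cancel except for the last row, where [M c.+1 = 0] cannot equal [e.+1]. *)
  rewrite !S ltn_ord; case: ltnP => [_|/M_n ->]; first by rewrite subrr.
  by rewrite subr0.
- rewrite big1 // => d _ /=; rewrite linearN linearNl /= -om_ypow // -ypowD om_ba.
  by rewrite oppr0 oppr0.
Qed.

Lemma rows_frame_span (f : 'Hom(W, k^o)) :
  (forall p j, f (ypow y j (frame_m p)) = 0) -> forall u, f u = 0.
Proof.
move=> f0; apply: row_span => i c; split; last exact: (f0 (inl i)).
(* On the chain [frame_m] is unitriangular in the [a], so the earlier terms are removed by strong
   induction on the row. *)
case: i => [d|x]; last exact: (f0 (inr (inr x))).
have [e] := ubnP (d : nat); elim: e d c => // e IHe d c lt_de.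
have := f0 (inr (inl d)) c; rewrite /= linear_sum linear_sum (bigD1 d) //= big1.
  by rewrite addr0 subnn ypow0.
move=> d' /andP[le_d ne_d]; rewrite -ypowD; apply: IHe.
by rewrite -ltnS; apply: leq_trans lt_de; rewrite ltnS ltn_neqAle ne_d.
Qed.

Lemma rows_frame_ord p : exists c e,
  ypow y (frame_order p) (frame_m p) = c *: ypow y e w.
Proof.
case: p => [i|[c|x]] /=.
- by exists 0, 0%N; rewrite scale0r b_ord.
(* Applying [y ^ (N c)] gives the first [c.+1] terms of [w]; the later terms are killed by
   [y ^ (M c.+1)], because [M d <= M c.+1] for [d > c]. *)
- exists 1, (M c.+1); rewrite scale1r wE !linear_sum /= big_mkcond /=.
  apply: eq_bigr => d _; case: leqP => [le_dc|lt_cd]; rewrite -!ypowD.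
    have leN : (N c <= N d)%N by apply: N_le; rewrite le_dc ltn_ord.
    by congr (ypow _ _ _); lia.
  have leM : (M d <= M c.+1)%N by apply: M_le.
  have -> : (M c.+1 + N d = (M c.+1 - M d) + row_ord (inl d))%N by rewrite /=; lia.
  by rewrite ypowD a_ord linear0.
- by exists 0, 0%N; rewrite scale0r (a_ord (inr x)).
Qed.

Lemma gramC p q c : rgram p q c = - rgram q p c.
Proof. by rewrite /gram omC om_ypow. Qed.

Lemma gram_inl i j c : rgram (inl i) (inl j) c = 0.
Proof. exact: om_aa. Qed.

Lemma om_chain_bb c e d : omega (ypow y e (chain_b c)) (b d) = 0.
Proof. by rewrite /chain_b; case: insubP => [i _ _|_]; rewrite ?om_bb // linear0 linear0l. Qed.

Lemma gram_inr p q c : rgram (inr p) (inr q) c = 0.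
Proof.
have B i j e : omega (ypow y e (chain_b i)) (chain_b j) = 0.
  by rewrite {2}/chain_b; case: insubP => [d _ _|_]; rewrite ?om_chain_bb // linear0r.
have B' i e d : omega (ypow y e (b d)) (chain_b i) = 0.
  by rewrite om_ypow // omC om_chain_bb oppr0.
rewrite /gram; case: p q => [d|x] [d'|x'] /=.
- rewrite [ypow _ _ (_ - _)]linearB linearBl !linearBr /= -!om_ypow // -!ypowD.
  by rewrite B om_chain_bb B' om_bb !subr0.
- by rewrite [ypow _ _ (_ - _)]linearB linearBl !linearNr /= -ypowD om_chain_bb om_bb !oppr0 addr0.
- by rewrite [ypow _ _ (- _)]linearN linearNl !linearBr /= -om_ypow // -ypowD B' om_bb subr0 oppr0.
- by rewrite [ypow _ _ (- _)]linearN linearNl linearNr /= om_bb !oppr0.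
Qed.

Lemma gram_lr i x c :
  rgram (inl i) (inr (inr x)) c = - ((i == inr x) && (c.+1 == l (tag x)))%:R.
Proof. by rewrite /gram /= linearNr /= om_ab; case: eqP => [->|]. Qed.

Lemma gram_lc i d c : rgram (inl i) (inr (inl d)) c != 0 ->
  (i = inl d /\ c.+1 = N d + M d.+1)%N \/
  exists2 d' : 'I_n, i = inl d' & d' = d.+1 :> nat /\ (c.+1 = M d' + N d')%N.
Proof.
rewrite /gram /= linearBr /= -om_ypow // -ypowD om_ab.
case: (eqVneq i (inl d)) => [-> | ne_i]; rewrite /=.
  case: (eqVneq (M d - M d.+1 + c).+1 (M d + N d)%N) => [E _|_].
    by left; split=> //; move: E (M_le (leqnSn d)); lia.
  rewrite subr0 /chain_b; case: insubP => [d' _ dE|_]; last by rewrite linear0r eqxx.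
  rewrite om_ab => /natr_bool_neq0/andP[/eqP[E] _].
  by move: dE => /eqP; rewrite -E ltn_eqF.
rewrite subr0 /chain_b; case: insubP => [d' _ dE|_]; last by rewrite linear0r eqxx.
rewrite om_ab => /natr_bool_neq0/andP[/eqP iE /eqP E].
by right; exists d' => //; split=> //; rewrite E iE.
Qed.

Definition in_levi (p : R + R) : bool :=
  match p with inl (inr _) | inr (inr _) => true | _ => false end.

Lemma has_dim_skewH :
  has_dim (skewH omega y w) (chart_dim frame_order (fun _ _ _ => true)).
Proof.
have [[[D F] S] O] := (rows_frame_dual, rows_frame_w, rows_frame_span, rows_frame_ord).
exists (chart omega y frame_order frame_m _), (chart_inv omega y frame_ms (g := _)).
split=> [||u||X [hX sX]].
- exact: chart_linear.
- exact: chart_inv_linear.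
- have hX := inH_chart_inv om_nondeg om_y D F S u.
  split=> //; apply/(sg_oppP om_nondeg om_y D F S O hX).
  exact: (sg_chart_inv om_nondeg om_y D F S O).
- exact: (chart_invK om_nondeg om_y D S).
apply: (chartK om_nondeg om_y D F S O) => //.
exact/(sg_oppP om_nondeg om_y D F S O hX).
Qed.

Hypothesis M_lt : forall d, (d < n)%N -> (M d.+1 < M d)%N.
Hypothesis N_lt : forall d, (d.+1 < n)%N -> (N d.+1 < N d)%N.

(** The two kinds of chain entries in [gram_lc] leave the margins [2 * (M d - M d.+1)] and
    [2 * (N d - N d.+1)]; strict decrease makes them at least 2, which pays for the two shifts. Levi
    entries have margin 0 and no shift. *)
Lemma rows_gram_deg p q c : rgram p q c != 0 ->
  (4 * c.+1 + ~~ in_levi p + ~~ in_levi q <= 2 * (frame_order p + frame_order q))%N.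
Proof.
have L i q' : rgram (inl i) (inr q') c != 0 ->
  (4 * c.+1 + ~~ in_levi (inl i) + ~~ in_levi (inr q')
     <= 2 * (frame_order (inl i) + frame_order (inr q')))%N.
  case: q' => [d|x].
    move=> /gram_lc[[-> E]|[d' -> [dE E]]] /=.
      by have := M_lt (ltn_ord d); lia.
    by have := @N_lt d; rewrite -dE => /(_ (ltn_ord _)); lia.
  rewrite gram_lr oppr_eq0 => /natr_bool_neq0/andP[/eqP -> /eqP E] /=. by rewrite -E; lia.
case: p q => [i|i] [j|j]; rewrite ?gram_inl ?gram_inr ?eqxx //; first exact: L.
by rewrite gramC oppr_eq0 addnAC (addnC (frame_order _)) => /L.
Qed.

Lemma rows_gram_lev p q c : in_levi p -> rgram p q c != 0 ->
  [/\ in_levi q, frame_order q = frame_order p & frame_order p = c.+1].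
Proof.
case: p q => [i|i] [j|j]; rewrite ?gram_inl ?gram_inr ?eqxx //; case: i => // x _.
  case: j => [d|z]; first by move=> /gram_lc[[]|[]].
  by rewrite gram_lr oppr_eq0 => /natr_bool_neq0/andP[/eqP[->] /eqP E] /=.
by rewrite gramC oppr_eq0 gram_lr oppr_eq0 => /natr_bool_neq0/andP[/eqP -> /eqP E] /=.
Qed.

(** The generators [a], whose duals are the [- b], come first: in this order the Gram matrix is
    [Jmx] and not its opposite. *)
Definition levi_idx h (i : 'I_(r h + r h)) : R + R :=
  match split i with
  | inl j => inr (inr (Tagged _ j))
  | inr j => inl (inr (Tagged _ j))
  end.
Arguments levi_idx : clear implicits.

Lemma levi_idx_inj h : injective (levi_idx h).
Proof.
move=> i j; rewrite -[i]splitK -[j]splitK /levi_idx !unsplitK.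
case: (split i) (split j) => [a1|a1] [a2|a2] //= [] /eqP; rewrite eq_Tagged /= => /eqP <- //.
Qed.

Lemma in_leviP p : in_levi p -> exists h i, p = levi_idx h i.
Proof.
case: p => [[//|[h i]]|[//|[h i]]] _.
  by exists h, (rshift _ i); rewrite /levi_idx (unsplitK (inr i)).
by exists h, (lshift _ i); rewrite /levi_idx (unsplitK (inl i)).
Qed.

Lemma levi_idx_in h i : in_levi (levi_idx h i).
Proof. by rewrite /levi_idx; case: split. Qed.

Lemma levi_idx_ord h i : frame_order (levi_idx h i) = l h.
Proof. by rewrite /levi_idx; case: split. Qed.

Lemma rows_gram_levi h i j : (0 < l h)%N ->
  rgram (levi_idx h i) (levi_idx h j) (l h).-1 = Jmx k (r h) i j.
Proof.
move=> l_gt0.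
have T (a1 a2 : 'I_(r h)) : ((inr (Tagged _ a1) : R) == inr (Tagged _ a2)) = (a1 == a2).
  by rewrite -[RHS](@eq_Tagged _ _ (Tagged (fun h => 'I_(r h)) a1) a2).
rewrite /Jmx /block_mx /levi_idx !mxE.
case: (split i) => a1; rewrite !mxE; case: (split j) => a2; rewrite ?gram_inl ?gram_inr !mxE //.
  by rewrite gramC gram_lr opprK prednK // eqxx andbT T eq_sym.
by rewrite gram_lr prednK // eqxx andbT T.
Qed.

Hypothesis l_gt0 : forall h, (0 < l h)%N.
Hypothesis l_inj : injective l.

(** The number [d] is left implicit: the last clause determines it once the dimension of the skew
    elements is known from another frame. *)
Theorem stab_structure : exists (U L : 'End(W) -> Prop) (d : nat),
  [/\ alg_semidirect_product (Sp_stab omega (w, y)) U L,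
      isomorphic_alg_groups L (fun g h => (g \o h)%VF) (@Sp_prod k _ r)
        (fun A B => A *m B),
      unipotent U,
      isomorphic_varieties U (@affine_space k d) &
      has_dim (skewH omega y w) (d + \sum_h (2 * r h ^ 2 + r h))].
Proof.
have [[[D F] S] O] := (rows_frame_dual, rows_frame_w, rows_frame_span, rows_frame_ord).
exists (Ugrp omega y w frame_order frame_m frame_ms in_levi).
exists (Lgrp omega y w frame_order frame_m frame_ms in_levi).
exists (chart_dim frame_order (non_levi frame_order in_levi)); split.
- exact: (semidirect_stab om_nondeg om_y D F S O rows_gram_deg rows_gram_lev).
- apply: (Lgrp_Sp_prod om_nondeg om_y D F S O rows_gram_deg rows_gram_lev l_gt0 l_inj
    (@levi_idx_inj) (@levi_idx_in) in_leviP (@levi_idx_ord)) => h i j.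
  exact: rows_gram_levi.
- exact: (unipotent_Ugrp om_nondeg om_y D F S O rows_gram_deg).
- exact: (Ugrp_affine om_nondeg om_alt om_y om_y_alt D F S O rows_gram_deg).
rewrite (chart_dim_split l_gt0 l_inj (@levi_idx_inj) (@levi_idx_in) in_leviP (@levi_idx_ord)).
exact: has_dim_skewH.
Qed.

End Rows.

(** * Jordan bases and their dual functionals *)

Section JordanBasis.
Variables (k : fieldType) (V : vectType k) (x : 'End(V)) (lam : seq nat).
Variable (e : nat -> nat -> V).
Hypothesis jb : jordan_basis lam x e.

Lemma jordan_iter c i j : (i < size lam)%N -> (j <= nth 0%N lam i)%N ->
  ypow x c (e i j) = e i (j - c)%N.
Proof.
have [e0 _ xe] := jb; move=> lt_i; elim: c j => [|c IHc] j le_j.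
  by rewrite ypow0 subn0.
rewrite ypowS IHc // subnS; case E: (j - c)%N => [|q] /=; first by rewrite e0 linear0.
by rewrite xe //; lia.
Qed.

Lemma jordan_ext (f : 'Hom(V, k^o)) :
  (forall i j, (i < size lam)%N -> (j < nth 0%N lam i)%N -> f (e i j.+1) = 0) ->
  forall u, f u = 0.
Proof.
have [_ be _] := jb; move=> f0 u.
have sub : (<<[seq e i j.+1 | i <- iota 0 (size lam), j <- iota 0 (nth 0%N lam i)]>>
    <= lker f)%VS.
  apply/span_subvP => _ /allpairsPdep[i [j [hi hj ->]]].
  by move: hi hj; rewrite !mem_iota !add0n memv_ker /= => hi hj; rewrite f0.
rewrite (span_basis be) in sub.
by apply/eqP; rewrite -memv_ker (subvP sub) ?memvf.
Qed.

(** The coordinate along [e i 1]. Transposition reverses a row: composing with [ypow x c] gives the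
    coordinate along [e i c.+1], so this functional generates the dual row. *)
Definition jordan_dual i : 'Hom(V, k^o) :=
  linfun (sval (linear_of_free
    [seq e i' j.+1 | i' <- iota 0 (size lam), j <- iota 0 (nth 0%N lam i')]
    [seq ((i == i') && (j == 0%N))%:R : k^o | i' <- iota 0 (size lam),
      j <- iota 0 (nth 0%N lam i')])).

Lemma jordan_dualE i i' j : (i' < size lam)%N -> (j <= nth 0%N lam i')%N ->
  jordan_dual i (e i' j) = ((i == i') && (j == 1%N))%:R.
Proof.
have [e0 be _] := jb; case: j => [|j] lt_i' lt_j.
  by rewrite e0 linear0 andbF.
rewrite lfunE /=; case: linear_of_free => f /= fP.
have := fP (basis_free be); rewrite !size_allpairs_dep => /(_ erefl).
by rewrite map_allpairs => /eq_in_allpairs_dep; apply; rewrite mem_iota.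
Qed.

End JordanBasis.

(** * Rows of the symplectic space *)

Section Transport.
Variables (k : fieldType) (V W : vectType k) (omega : {skew_symmetric W}).
Variables (f : 'Hom(Vsum V, W)) (x : 'End(V)) (y : 'End(W)).
Hypothesis f_isom : forall a b, omega (f a) (f b) = Vsum_form a b.
Hypothesis f_surj : forall u, exists a, u = f a.
Hypothesis yf : forall a, y (f a) = f (Vsum_end x a).

Lemma pullback_alt a : omega a a = 0.
Proof. by have [u ->] := f_surj a; rewrite f_isom /Vsum_form subrr. Qed.

Lemma pullback_adj a b : omega (y a) b = omega a (y b).
Proof.
have [[u p] ->] := f_surj a; have [[v q] ->] := f_surj b.
by rewrite !yf !f_isom !Vsum_endE /Vsum_form /= !comp_lfunE.
Qed.

Lemma pullback_adj_alt a : omega (y a) a = 0.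
Proof.
have [[u p] ->] := f_surj a.
by rewrite yf f_isom Vsum_endE /Vsum_form /= comp_lfunE subrr.
Qed.

Lemma ypow_f c u p : ypow y c (f (u, p)) = f (ypow x c u, (p \o ypow x c)%VF).
Proof.
elim: c => [|c IHc]; first by rewrite !ypow0 /ypow /= comp_lfun1r.
rewrite !ypowS IHc yf Vsum_endE /=; congr (f (_, _)).
apply/lfunP => v; rewrite !comp_lfunE; congr (p _).
by rewrite -?ypowS -addn1 ypowD ypowS ypow0.
Qed.

Variables (lam : seq nat) (e : nat -> nat -> V).
Hypothesis jb : jordan_basis lam x e.
Variables (R : finType) (rho : R -> nat) (ro : R -> nat).
Hypothesis rho_lt : forall i, (rho i < size lam)%N.
Hypothesis rho_inj : injective rho.
Hypothesis rho_surj : forall i, (i < size lam)%N -> exists z, i = rho z.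
Hypothesis roE : forall i, ro i = nth 0%N lam (rho i).

Definition row_a i : W := f (e (rho i) (ro i), 0).
Definition row_b i : W := f (0, jordan_dual lam e (rho i)).

Lemma f_zero : f (0, 0) = 0. Proof. exact: (linear0 f). Qed.

Lemma ypow_a c i : ypow y c (row_a i) = f (e (rho i) (ro i - c)%N, 0).
Proof.
by rewrite /row_a ypow_f (jordan_iter jb) ?comp_lfun0l // roE.
Qed.

Lemma ypow_b c i : ypow y c (row_b i) = f (0, (jordan_dual lam e (rho i) \o ypow x c)%VF).
Proof. by rewrite /row_b ypow_f linear0. Qed.

Lemma row_a_ord i : ypow y (ro i) (row_a i) = 0.
Proof. by have [e0 _ _] := jb; rewrite ypow_a subnn e0 f_zero. Qed.

Lemma row_b_ord i : ypow y (ro i) (row_b i) = 0.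
Proof.
rewrite ypow_b -[RHS]f_zero; congr (f (_, _)); apply/lfunP => u.
rewrite zero_lfunE; apply: (jordan_ext jb) => i' j lt_i' lt_j.
rewrite comp_lfunE (jordan_iter jb) // (jordan_dualE jb) //; last by lia.
by rewrite roE; case: eqP => [->|] //=; case: eqP => //; lia.
Qed.

Lemma row_aa c i j : omega (ypow y c (row_a i)) (row_a j) = 0.
Proof. by rewrite ypow_a f_isom /Vsum_form /= !zero_lfunE [LHS]subrr. Qed.

Lemma row_bb c i j : omega (ypow y c (row_b i)) (row_b j) = 0.
Proof. by rewrite ypow_b f_isom /Vsum_form /= !linear0 [LHS]addr0. Qed.

Lemma row_ab c i j :
  omega (ypow y c (row_a i)) (row_b j) = ((i == j) && (c.+1 == ro i))%:R.
Proof.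
rewrite ypow_a f_isom /Vsum_form /= zero_lfunE (jordan_dualE jb) //; last first.
  by rewrite roE leq_subr.
rewrite [LHS]subr0 (inj_eq rho_inj) eq_sym; congr (_ && _)%:R.
by apply/eqP/eqP; lia.
Qed.

Lemma row_spanP (h : 'Hom(W, k^o)) :
  (forall i c, h (ypow y c (row_a i)) = 0 /\ h (ypow y c (row_b i)) = 0) ->
  forall u, h u = 0.
Proof.
move=> h0 u; have [[v p] ->] := f_surj u.
have -> : f (v, p) = f (v, 0) + f (0, p).
  by rewrite -linearD; congr (f _); congr pair; rewrite /= ?addr0 ?add0r.
rewrite linearD /=.
have iL1 : linear (fun v : V => h (f (v, 0)) : k^o).
  move=> c v1 v2; rewrite -!linearZ -!linearD; congr (h (f _)).
  by congr pair; rewrite /= ?scaler0 ?addr0.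
pose h1 : {linear V -> k^o} := HB.pack (fun v : V => h (f (v, 0)) : k^o)
  (GRing.isLinear.Build _ _ _ _ _ iL1).
have E : linfun h1 v = 0.
  apply: (jordan_ext jb) => i j lt_i lt_j.
  have [z iz] := rho_surj lt_i; rewrite lfunE /=.
  have [+ _] := h0 z (ro z - j.+1)%N; rewrite ypow_a -iz.
  by rewrite subKn // roE -iz.
rewrite lfunE /= in E; rewrite {}E.
rewrite add0r.
(* Expansion of [p] in the basis dual to the Jordan basis. *)
have -> : p = \sum_(z : R) \sum_(c < ro z)
     p (e (rho z) c.+1) *: (jordan_dual lam e (rho z) \o ypow x c)%VF.
  apply/eqP; rewrite -subr_eq0; apply/eqP/lfunP => v'.
  rewrite zero_lfunE; apply: (jordan_ext jb) => i j lt_i lt_j.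
  have [z iz] := rho_surj lt_i.
  rewrite add_lfunE opp_lfunE sum_lfunE (sum_only (i := z)) => [|z' ne_z].
    rewrite sum_lfunE (sum_ord_only (j := j) (F := fun c =>
      (p (e (rho z) c.+1) *: (jordan_dual lam e (rho z) \o ypow x c)%VF) (e i j.+1))).
      rewrite roE -iz lt_j scale_lfunE comp_lfunE (jordan_iter jb) //.
      rewrite (jordan_dualE jb) //; last by lia.
      by rewrite eqxx subSnn [_ *: _]mulr1 subrr.
    move=> c lt_c ne_c; rewrite scale_lfunE comp_lfunE (jordan_iter jb) //.
    rewrite (jordan_dualE jb) //; last by lia.
    rewrite iz eqxx /=; case: eqP; rewrite ?scaler0 //; lia.
  rewrite sum_lfunE big1 // => c _; rewrite scale_lfunE comp_lfunE (jordan_iter jb) //.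
  rewrite (jordan_dualE jb) //; last by lia.
  by rewrite iz (inj_eq rho_inj) (negPf ne_z) scaler0.
have iL2 : linear (fun q : dualspace V => h (f (0, q)) : k^o).
  move=> c v1 v2; rewrite -!linearZ -!linearD; congr (h (f _)).
  by congr pair; rewrite /= ?scaler0 ?addr0.
pose h2 : {linear dualspace V -> k^o} := HB.pack (fun q : dualspace V => h (f (0, q)) : k^o)
  (GRing.isLinear.Build _ _ _ _ _ iL2).
rewrite -[LHS]/(h2 _) linear_sum big1 // => z _; rewrite linear_sum big1 // => c _.
by rewrite linearZ /= -ypow_b; have [_ ->] := h0 z c; rewrite scaler0.
Qed.

End Transport.

(* A row [i] may be absorbed into a row [f] with [mu_i <= mu_f] and
   [nu_f <= nu_i]: replacing [e f j] by [e f j + e i (j + mu_i - mu_f)] gives a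
   Jordan basis in which the [i]-th term of [v] has disappeared. *)
Lemma jordan_absorb (k : fieldType) (V : vectType k) (x : 'End(V))
    (lam : seq nat) (mu nu : nat -> nat) (e : nat -> nat -> V)
    (S : pred nat) (tgt : nat -> nat) :
  jordan_basis lam x e ->
  (forall i, (i < size lam)%N -> nth 0%N lam i = (mu i + nu i)%N) ->
  (forall i, (i < size lam)%N -> (0 < mu i)%N ->
     [/\ (tgt i < size lam)%N, S (tgt i), (mu i <= mu (tgt i))%N,
         (nu (tgt i) <= nu i)%N & S i -> tgt i = i]) ->
  exists2 e', jordan_basis lam x e' &
    \sum_(i < size lam) e i (mu i) = \sum_(i < size lam | S i) e' i (mu i).
Proof.
move=> [e0 be xe] lamE tgtP; set l := size lam in lamE tgtP *.
pose A i' i := [&& ~~ S i', (0 < mu i')%N & tgt i' == i].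
(* At [j = mu i] the correction is the term [e i' (mu i')] of [v]. For small [j] the truncated
   subtraction gives [e i' 0 = 0], and [nu i <= nu i'] keeps the index within row [i']. *)
pose e' i j := e i j + if S i then \sum_(i' < l | A i' i) e i' (j + mu i' - mu i)%N else 0.
have AP (i' : 'I_l) i : A i' i -> [/\ (mu i' <= mu i)%N & (nu i <= nu i')%N].
  by move=> /and3P[_ mu_gt /eqP <-]; have [] := tgtP _ (ltn_ord i') mu_gt.
exists e'; last first.
  under [RHS]eq_bigr => i Si do rewrite /e' Si.
  rewrite big_split /= [LHS](bigID (fun i : 'I_l => S i)) /=; congr (_ + _).
  rewrite (exchange_big_dep (fun i' : 'I_l => ~~ S i')) /=; last first.
    by move=> i i' _ /and3P[].
  apply: eq_bigr => i' nSi'; case: (posnP (mu i')) => [m0|m_gt].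
    by rewrite m0 e0 big1 // => i /andP[_ /and3P[_ + _]]; rewrite m0.
  have [lt_t St _ _ _] := tgtP _ (ltn_ord i') m_gt.
  rewrite (big_pred1 (Ordinal lt_t)) => [|i]; first by rewrite /= addnC addnK.
  rewrite /A nSi' m_gt /=; apply/andP/eqP => [[_ /eqP E]|->]; first exact/val_inj.
  by rewrite eqxx.
have e'0 i : e' i 0%N = 0.
  rewrite /e' e0 add0r; case: ifP => // _; rewrite big1 // => i' /AP[le_mu _].
  by rewrite add0n (eqP (_ : (_ - _)%N == 0%N)) // subn_eq0.
split=> //; last first.
  move=> i j lt_i lt_j; rewrite /e' linearD /= xe //; congr (_ + _).
  case: ifP => Si; last by rewrite linear0.
  rewrite linear_sum; apply: eq_bigr => i' /AP[le_mu le_nu] /=.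
  have := lamE _ lt_i; have := lamE _ (ltn_ord i') => E1 E2.
  case: (leqP (j.+1 + mu i') (mu i)) => [le_j|lt_j'].
    have -> : (j.+1 + mu i' - mu i = 0)%N by lia.
    have -> : (j + mu i' - mu i = 0)%N by lia.
    by rewrite e0 linear0.
  have -> : (j.+1 + mu i' - mu i = (j + mu i' - mu i).+1)%N by lia.
  by rewrite xe //; rewrite E2 in lt_j; lia.
rewrite basisEdim; apply/andP; split; last first.
  have := be; rewrite basisEdim => /andP[_]; by rewrite !size_allpairs_dep.
rewrite -(span_basis be); apply/span_subvP => _ /allpairsPdep[i [j [hi hj ->]]].
have inX i' j' : (i' < l)%N -> (j' <= nth 0%N lam i')%N ->
  e' i' j' \in <<[seq e' i j.+1 | i <- iota 0 l, j <- iota 0 (nth 0%N lam i)]>>%VS.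
  move=> lt_i'; case: j' => [|j'] lt_j'; first by rewrite e'0 mem0v.
  apply/memv_span/allpairsPdep; exists i', j'; rewrite !mem_iota !add0n.
  by split.
move: hi hj; rewrite !mem_iota !add0n /= => lt_i lt_j.
(* The change of basis is inverted by a sign, because the corrections only involve rows outside [S],
   which are left unchanged. *)
have eE : e i j.+1 = e' i j.+1 -
  if S i then \sum_(i' < l | A i' i) e' i' (j.+1 + mu i' - mu i)%N else 0.
  rewrite {1}/e'; case: ifP => Si; last by rewrite addr0 subr0.
  rewrite -addrA [X in _ + X](_ : _ = 0) ?addr0 //; apply/eqP; rewrite subr_eq0; apply/eqP.
  by apply: eq_bigr => i' /and3P[/negPf nS _ _]; rewrite /e' nS addr0.
rewrite eE rpredB ?inX //; case: ifP => _; last exact: mem0v.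
apply: rpred_sum => i' /AP[le_mu le_nu]; apply: inX => //.
by have := lamE _ lt_i; have := lamE _ (ltn_ord i') => -> E; rewrite E in lt_j; lia.
Qed.

(** * Blocks *)

Section Blocks.
Local Open Scope nat_scope.
Variables mu nu : seq nat.
Hypotheses (mu_part : is_partition mu) (nu_part : is_partition nu).
Local Notation lam := (part_add mu nu).
Local Notation ds := (dparts mu nu).

Lemma partition_le (p : seq nat) i j : is_partition p -> i <= j -> nth 0 p j <= nth 0 p i.
Proof.
move=> /andP[sp _] le_ij; case: (ltnP j (size p)) => [lt_j|le_j]; last first.
  by rewrite nth_default.
have := sorted_leq_nth (leT := geq) _ _ 0 sp => /= th.
apply: th => //; rewrite ?inE //; last exact: leq_ltn_trans lt_j.
  by move=> a b c /= ab bc; apply: leq_trans bc ab.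
by move=> a /=.
Qed.

Lemma partition_gt0 (p : seq nat) i : is_partition p -> i < size p -> 0 < nth 0 p i.
Proof. by move=> /andP[_ p0] lt_i; rewrite lt0n; apply: contraNneq p0 => <-; apply: mem_nth. Qed.

Lemma size_part_add : size lam = maxn (size mu) (size nu).
Proof. by rewrite size_mkseq. Qed.

Lemma nth_part_add i : nth 0 lam i = nth 0 mu i + nth 0 nu i.
Proof.
case: (ltnP i (size lam)) => [|le_i].
  by rewrite size_part_add => lt_i; rewrite nth_mkseq.
rewrite nth_default //; move: le_i; rewrite size_part_add geq_max => /andP[le1 le2].
by rewrite !nth_default.
Qed.

Lemma part_add_partition : is_partition lam.
Proof.
apply/andP; split.
  apply/(sortedP 0) => i _.
  by rewrite !nth_part_add /= leq_add // partition_le.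
apply/negP => /(nthP 0)[i lt_i]; rewrite nth_part_add => /eqP; rewrite addn_eq0 => /andP[m0 n0].
move: lt_i; rewrite size_part_add leq_max => /orP[] /partition_gt0.
  by move=> /(_ mu_part); rewrite (eqP m0).
by move=> /(_ nu_part); rewrite (eqP n0).
Qed.

Lemma dparts_sorted : sorted gtn ds.
Proof.
rewrite gtn_sorted_uniq_geq undup_uniq /=.
apply: (subseq_sorted _ (undup_subseq _)); last by case/andP: part_add_partition.
by move=> a b c /= ab bc; apply: leq_trans bc ab.
Qed.

Lemma dparts_lt h h' : h < h' < size ds -> nth 0 ds h' < nth 0 ds h.
Proof.
move=> /andP[lt_h lt_h']; have := sorted_ltn_nth (leT := gtn) _ 0 dparts_sorted => th.
apply: th => //; rewrite ?inE //; last exact: ltn_trans lt_h'.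
by move=> a b c /= ab bc; apply: ltn_trans bc ab.
Qed.

Lemma dparts_mem h : h < size ds -> nth 0 ds h \in lam.
Proof. by move=> lt_h; rewrite -mem_undup mem_nth. Qed.

Lemma dparts_gt0 h : h < size ds -> 0 < nth 0 ds h.
Proof.
move=> /dparts_mem; rewrite lt0n; apply: contraTneq => ->.
by case/andP: part_add_partition.
Qed.

Definition first h := index (nth 0 ds h) lam.
Definition last_row h := first h + (mult mu nu h).-1.

Lemma nth_sorted_eq (p : seq nat) v i : sorted geq p -> i < size p ->
  (nth 0 p i == v) = (index v p <= i < index v p + count_mem v p).
Proof.
elim: p i => //= a p IHp i sp lt_i.
have sp' : sorted geq p by exact: path_sorted sp.
have all_p : all (geq a) p.
  by apply: (order_path_min _ sp) => u z t /= uz zt; apply: leq_trans zt uz.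
case: (eqVneq a v) => [av|ne_av] /=; last first.
  case: i lt_i => [|i] lt_i; first by rewrite (negPf ne_av).
  by rewrite /= IHp // add0n addSn ltnS.
case: i lt_i => [|i] lt_i; first by rewrite /= av eqxx.
rewrite /= add0n add1n ltnS.
have [vp|nvp] := boolP (v \in p); last first.
  rewrite (count_memPn nvp) ltn0; apply: contraNF nvp => /eqP <-.
  exact: mem_nth.
rewrite IHp //; suff -> : index v p = 0 by [].
case: p vp all_p sp' {IHp sp lt_i} => //= b p vp /andP[ab _] sp'.
have all_p : all (geq b) p.
  by apply: (order_path_min _ sp') => u z t /= uz zt; apply: leq_trans zt uz.
case: eqP => // /eqP ne_bv; move: vp; rewrite inE eq_sym (negPf ne_bv) /= => vp.
have /= := allP all_p _ vp; rewrite -av => ba.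
by case/eqP: ne_bv; rewrite -av; apply/eqP; rewrite eqn_leq ab ba.
Qed.

Lemma nth_block h i : i < size lam ->
  (nth 0 lam i == nth 0 ds h) = (first h <= i < first h + mult mu nu h).
Proof. by move=> lt_i; rewrite nth_sorted_eq //; case/andP: part_add_partition. Qed.

Lemma mult_gt0 h : h < size ds -> 0 < mult mu nu h.
Proof. by move=> /dparts_mem; rewrite -has_pred1 has_count. Qed.

Lemma block_lt h i : h < size ds -> i < first h + mult mu nu h -> i < size lam.
Proof.
move=> lt_h; apply: contraTT; rewrite -!leqNgt => le_i; apply: leq_trans le_i.
rewrite /first /mult; elim: (lam) => //= a p IHp.
by case: eqP => _; rewrite ?add0n ?add1n ?addSn ltnS // count_size.
Qed.

Lemma nth_first h i : h < size ds -> i < mult mu nu h ->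
  nth 0 lam (first h + i) = nth 0 ds h.
Proof.
move=> lt_h lt_i; apply/eqP; rewrite nth_block ?leq_addr ?ltn_add2l //.
by apply: (block_lt lt_h); rewrite ltn_add2l.
Qed.

Definition jv h := nth 0 (block_values mu nu mu) h.
Definition kv h := nth 0 (block_values mu nu nu) h.

Lemma block_valuesE (r : seq nat) h : h < size ds ->
  nth 0 (block_values mu nu r) h = nth 0 r (first h).
Proof. by move=> lt_h; rewrite (nth_map 0). Qed.

Lemma block_values_out (r : seq nat) h : size ds <= h -> nth 0 (block_values mu nu r) h = 0.
Proof. by move=> le_h; rewrite nth_default // size_map. Qed.

Lemma jkv_sum h : h < size ds -> jv h + kv h = nth 0 ds h.
Proof.
move=> lt_h; rewrite /jv /kv !block_valuesE // -nth_part_add.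
by rewrite -[first h]addn0 nth_first // mult_gt0.
Qed.

(** Two nonincreasing sequences whose sum is constant on a block are both constant there. *)
Lemma row_values h i : h < size ds -> i < size lam -> nth 0 lam i = nth 0 ds h ->
  nth 0 mu i = jv h /\ nth 0 nu i = kv h.
Proof.
move=> lt_h lt_i E; have := jkv_sum lt_h; rewrite -E nth_part_add /jv /kv !block_valuesE //.
have /andP[le_f _] : first h <= i < first h + mult mu nu h by rewrite -nth_block // E.
have := partition_le mu_part le_f; have := partition_le nu_part le_f; lia.
Qed.

Lemma first_le h h' : h <= h' < size ds -> first h <= first h'.
Proof.
move=> /andP[]; rewrite leq_eqVlt => /orP[/eqP -> //|lt_h lt_h'].
have lt_hs := ltn_trans lt_h lt_h'.
rewrite leqNgt; apply/negP => /ltnW /(partition_le part_add_partition).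
rewrite -[first h]addn0 -[first h']addn0 !nth_first ?mult_gt0 //.
by rewrite leqNgt dparts_lt // lt_h.
Qed.

Lemma jv_le h h' : h <= h' -> jv h' <= jv h.
Proof.
move=> le_h; have [lt_h'|le_s] := ltnP h' (size ds); last by rewrite /jv block_values_out.
rewrite /jv !block_valuesE ?(leq_ltn_trans le_h) //.
by apply: partition_le => //; rewrite first_le // le_h.
Qed.

Lemma kv_le h h' : h <= h' -> kv h' <= kv h.
Proof.
move=> le_h; have [lt_h'|le_s] := ltnP h' (size ds); last by rewrite /kv block_values_out.
rewrite /kv !block_valuesE ?(leq_ltn_trans le_h) //.
by apply: partition_le => //; rewrite first_le // le_h.
Qed.

Lemma JsetE h : Jset mu nu h = (jv h.+1 < jv h) && ((h == 0) || (kv h < kv h.-1)).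
Proof. by []. Qed.

(** The drop of [j] occurs just after [h] and that of [k] just before [h']. This is the source of
    the strict decrease required by the grading. *)
Lemma Jset_lt h h' : h < h' -> Jset mu nu h -> Jset mu nu h' ->
  (jv h' < jv h) && (kv h' < kv h).
Proof.
move=> lt_h; rewrite !JsetE => /andP[j_h _] /andP[_ k_h'].
have := jv_le lt_h; have : kv h'.-1 <= kv h by apply: kv_le; lia.
by lia.
Qed.

(* Blocks are ordered by [h <= f] when [j_h <= j_f] and [k_f <= k_h]; the set [J]
   consists of the maximal blocks with [j_h > 0]. *)
Definition dominates f h := [&& f < size ds, Jset mu nu f, jv h <= jv f & kv f <= kv h].

(** Take a dominating block maximising [F]. If [j] did not drop after [f], block [f.+1] would have
    the same [j] and a smaller [k]; if [k] did not drop before [f], block [f.-1] would have the same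
    [k] and a larger [j]. After the last block, [j] drops to 0 since [jv h] is positive. *)
Lemma dominates_ex h : h < size ds -> 0 < jv h -> exists f, dominates f h.
Proof.
move=> lt_h j_gt.
pose Q (f : 'I_(size ds)) := (jv h <= jv f) && (kv f <= kv h).
pose F (f : 'I_(size ds)) := jv f + (kv h - kv f).
have Qh : Q (Ordinal lt_h) by rewrite /Q /= !leqnn.
have [f /andP[jf kf] fmax] := arg_maxnP F Qh.
exists f; rewrite /dominates ltn_ord jf kf JsetE !andbT /=; apply/andP; split.
  rewrite ltnNge; apply/negP => j_f1.
  have [lt_f1|le_f1] := ltnP f.+1 (size ds); last first.
    have j0 : jv f.+1 = 0 by rewrite /jv block_values_out.
    by move: j_f1 jf j_gt; rewrite j0; lia.
  have := fmax (Ordinal lt_f1); rewrite /Q /F /=.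
  have := jkv_sum lt_f1; have := jkv_sum (ltn_ord f).
  have : nth 0 ds f.+1 < nth 0 ds f by apply: dparts_lt; rewrite ltnSn.
  have := jv_le (leqnSn f); lia.
case: (posnP f) => [-> //|f_gt]; apply/orP; right.
rewrite ltnNge; apply/negP => k_f1.
have lt_f1 : f.-1 < size ds by rewrite (leq_ltn_trans (leq_pred _)).
have := fmax (Ordinal lt_f1); rewrite /Q /F /=.
have := jkv_sum lt_f1; have := jkv_sum (ltn_ord f).
have : nth 0 ds f < nth 0 ds f.-1 by apply: dparts_lt; rewrite ltn_ord andbT; lia.
have := kv_le (leq_pred f); lia.
Qed.

Definition Jblocks := [seq h <- iota 0 (size ds) | Jset mu nu h].
Local Notation nc := (size Jblocks).
(** The default lies past the last block, where [jv] and [kv] are 0: the chain is prolonged by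
    zeros. *)
Definition Jblock c := nth (size ds) Jblocks c.
Definition chainM c := jv (Jblock c).
Definition chainN c := kv (Jblock c).

Lemma JblockP c : c < nc -> Jblock c < size ds /\ Jset mu nu (Jblock c).
Proof.
move=> /(mem_nth (size ds)); rewrite -/(Jblock c) mem_filter mem_iota add0n /=.
by case/andP.
Qed.

Lemma Jblock_lt c d : c < d < nc -> Jblock c < Jblock d.
Proof.
move=> /andP[lt_c lt_d].
have srt : sorted ltn Jblocks.
  by apply: sorted_filter (iota_ltn_sorted _ _); apply: ltn_trans.
by apply: (sorted_ltn_nth ltn_trans _ srt); rewrite ?inE // (ltn_trans lt_c).
Qed.

Lemma chain_out c : nc <= c -> chainM c = 0 /\ chainN c = 0.
Proof.
by move=> le_c; rewrite /chainM /chainN /Jblock nth_default // /jv /kv !block_values_out.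
Qed.

Lemma chainM_lt c : c < nc -> chainM c.+1 < chainM c.
Proof.
move=> lt_c; have [_ Jc] := JblockP lt_c.
have [lt_c1|le_c1] := ltnP c.+1 nc.
  have [_ Jc1] := JblockP lt_c1.
  by have /andP[] := Jset_lt (Jblock_lt (introT andP (conj (ltnSn c) lt_c1))) Jc Jc1.
have [-> _] := chain_out le_c1.
by move: Jc; rewrite JsetE => /andP[+ _]; apply: leq_ltn_trans.
Qed.

Lemma chainN_lt c : c.+1 < nc -> chainN c.+1 < chainN c.
Proof.
move=> lt_c1; have [_ Jc] := JblockP (ltnW lt_c1); have [_ Jc1] := JblockP lt_c1.
by have /andP[] := Jset_lt (Jblock_lt (introT andP (conj (ltnSn c) lt_c1))) Jc Jc1.
Qed.

Lemma Jblock_le c d : c <= d -> Jblock c <= Jblock d.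
Proof.
rewrite leq_eqVlt => /orP[/eqP -> //|lt_cd].
have [lt_d|le_d] := ltnP d nc; first by rewrite ltnW // Jblock_lt // lt_cd.
rewrite [Jblock d]nth_default //.
have [/JblockP[/ltnW] //|le_c] := ltnP c nc.
by rewrite /Jblock nth_default.
Qed.

Lemma chainM_le c d : c <= d -> chainM d <= chainM c.
Proof. by move=> /Jblock_le/jv_le. Qed.

Lemma chainN_le c d : c <= d -> chainN d <= chainN c.
Proof. by move=> /Jblock_le/kv_le. Qed.

(** * Rows of the chain and rows of the Levi factor *)

Local Notation s := (size ds).
Local Notation rk := (@levi_rank mu nu).
Local Notation R := ('I_nc + {h : 'I_s & 'I_(rk h)})%type.

Definition row_block (z : R) : nat :=
  match z with inl c => Jblock c | inr u => tag u end.

(** A block of [J] gives its last row to the chain; the rows before it form an initial segment of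
    length [levi_rank]. *)
Definition row_pos (z : R) : nat :=
  match z with inl c => (mult mu nu (Jblock c)).-1 | inr u => tagged u end.

Definition row_of (z : R) : nat := first (row_block z) + row_pos z.

Lemma row_block_lt z : row_block z < s.
Proof. by case: z => [c|u] /=; [case: (JblockP (ltn_ord c))|apply: ltn_ord]. Qed.

Lemma levi_rank_le (h : 'I_s) : rk h <= mult mu nu h.
Proof. by rewrite /levi_rank; case: ifP => // _; apply: leq_pred. Qed.

Lemma row_pos_lt z : row_pos z < mult mu nu (row_block z).
Proof.
have := row_block_lt z; case: z => [c|u] /= lt_s.
  by rewrite prednK // mult_gt0.
exact: leq_trans (ltn_ord _) (levi_rank_le _).
Qed.

Lemma nth_row_of z : nth 0 lam (row_of z) = nth 0 ds (row_block z).
Proof. exact: nth_first (row_block_lt z) (row_pos_lt z). Qed.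

Lemma row_of_lt z : row_of z < size lam.
Proof. by apply: (block_lt (row_block_lt z)); rewrite ltn_add2l row_pos_lt. Qed.

Lemma row_of_ord z :
  row_ord chainM chainN (fun h : 'I_s => nth 0 ds h) z = nth 0 lam (row_of z).
Proof.
rewrite nth_row_of; case: z => [c|u] //=.
by rewrite jkv_sum //; case: (JblockP (ltn_ord c)).
Qed.

Lemma Jblock_inj c d : c < nc -> d < nc -> Jblock c = Jblock d -> c = d.
Proof.
move=> lt_c lt_d E; case: (ltngtP c d) => // lt_cd.
  by have := Jblock_lt (introT andP (conj lt_cd lt_d)); rewrite E ltnn.
by have := Jblock_lt (introT andP (conj lt_cd lt_c)); rewrite E ltnn.
Qed.

Lemma row_of_inj : injective row_of.
Proof.
move=> z z' E.
have Eb : row_block z = row_block z'.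
  have := nth_row_of z; rewrite E nth_row_of => /eqP.
  by rewrite nth_uniq ?row_block_lt ?undup_uniq // => /eqP.
have Ep : row_pos z = row_pos z' by apply: (@addnI (first (row_block z))); rewrite {2}Eb.
have lt_lev (u : {h : 'I_s & 'I_(rk h)}) c : c < nc -> Jblock c = tag u ->
    tagged u < (mult mu nu (Jblock c)).-1.
  move=> lt_c Ec; apply: leq_trans (ltn_ord (tagged u)) _; rewrite /levi_rank -Ec.
  by have [_ ->] := JblockP lt_c.
move: z z' Eb Ep {E} => [c|[h i]] [c'|[h' i']] /= Eb Ep.
- by congr inl; apply/val_inj/(Jblock_inj (ltn_ord c) (ltn_ord c') Eb).
- by have := lt_lev (Tagged _ i') c (ltn_ord c) Eb; rewrite Ep ltnn.
- by have := lt_lev (Tagged _ i) c' (ltn_ord c') (esym Eb); rewrite Ep ltnn.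
have hh' : h = h' by apply: val_inj.
by subst h'; congr (inr (Tagged _ _)); apply: val_inj.
Qed.

Definition block_of i := index (nth 0 lam i) ds.

Lemma block_of_lt i : i < size lam -> block_of i < s.
Proof. by move=> lt_i; rewrite index_mem mem_undup mem_nth. Qed.

Lemma nth_block_of i : i < size lam -> nth 0 ds (block_of i) = nth 0 lam i.
Proof. by move=> lt_i; rewrite nth_index // mem_undup mem_nth. Qed.

Lemma block_of_row z : block_of (row_of z) = row_block z.
Proof. by rewrite /block_of nth_row_of index_uniq ?row_block_lt ?undup_uniq. Qed.

Lemma Jblock_ex h : h < s -> Jset mu nu h -> exists c : 'I_nc, h = Jblock c.
Proof.
move=> lt_h Jh; have hin : h \in Jblocks by rewrite mem_filter Jh mem_iota.
have lt_c : index h Jblocks < nc by rewrite index_mem.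
by exists (Ordinal lt_c); rewrite /Jblock nth_index.
Qed.

Lemma row_of_surj i : i < size lam -> exists z, i = row_of z.
Proof.
move=> lt_i; have lt_b := block_of_lt lt_i.
have : first (block_of i) <= i < first (block_of i) + mult mu nu (block_of i).
  by rewrite -nth_block // nth_block_of.
move=> /andP[le_f lt_f].
have [lt_r|le_r] := ltnP (i - first (block_of i)) (rk (Ordinal lt_b)).
  exists (inr (Tagged (fun h : 'I_s => 'I_(rk h)) (Ordinal lt_r))).
  by rewrite /row_of /= subnKC.
move: le_r; rewrite /levi_rank /=; case: ifP => [Jb|_]; last by move=> *; lia.
have [c bc] := Jblock_ex lt_b Jb => le_r.
by exists (inl c); rewrite /row_of /= -bc; lia.
Qed.

Definition special i :=
  Jset mu nu (block_of i) && (i == last_row (block_of i)).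

Definition target i := last_row (find (dominates^~ (block_of i)) (iota 0 s)).

Lemma special_row i : i < size lam -> special i -> exists c : 'I_nc, i = row_of (inl c).
Proof.
move=> lt_i /andP[Jb /eqP ->].
by have [c ->] := Jblock_ex (block_of_lt lt_i) Jb; exists c.
Qed.

Lemma row_special (c : 'I_nc) : special (row_of (inl c)).
Proof. by rewrite /special block_of_row /=; have [_ ->] := JblockP (ltn_ord c) => /=. Qed.

Lemma row_values_of i : i < size lam ->
  nth 0 mu i = jv (block_of i) /\ nth 0 nu i = kv (block_of i).
Proof. by move=> lt_i; apply: row_values; rewrite ?block_of_lt ?nth_block_of. Qed.

(** By [Jset_lt], distinct blocks of [J] never dominate each other, so a special row is its own
    target whichever dominating block [find] returns. *)
Lemma targetP i : i < size lam -> 0 < nth 0 mu i ->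
  [/\ target i < size lam, special (target i), nth 0 mu i <= nth 0 mu (target i),
      nth 0 nu (target i) <= nth 0 nu i & special i -> target i = i].
Proof.
move=> lt_i mu_gt; have lt_b := block_of_lt lt_i.
have [mE nE] := row_values_of lt_i.
have [f0 df0] : exists f, dominates f (block_of i) by apply: dominates_ex; rewrite -?mE.
have hasf : has (dominates^~ (block_of i)) (iota 0 s).
  by apply/hasP; exists f0 => //; rewrite mem_iota; case/and4P: df0.
set f := find (dominates^~ (block_of i)) (iota 0 s).
have df : dominates f (block_of i).
  have := nth_find 0 hasf; rewrite nth_iota ?add0n //.
  by move: hasf; rewrite has_find size_iota.
have /and4P[lt_f Jf jf kf] := df.
have [c fc] := Jblock_ex lt_f Jf.
have tE : target i = row_of (inl c) by rewrite /target -/f fc.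
have [mtE ntE] := row_values_of (row_of_lt (inl c)).
rewrite tE row_of_lt row_special mE nE mtE ntE block_of_row /= -fc.
split=> // /andP[Jb /eqP iE]; rewrite [RHS]iE /row_of /= -fc -/(last_row f); congr last_row.
case: (ltngtP f (block_of i)) => // lt_fb.
  by have := Jset_lt lt_fb Jf Jb; lia.
by have := Jset_lt lt_fb Jb Jf; lia.
Qed.

Lemma sum_special (V : nmodType) (F : nat -> V) :
  (\sum_(i < size lam | special i) F i = \sum_(c < nc) F (row_of (inl c)))%R.
Proof.
pose h (c : 'I_nc) := Ordinal (row_of_lt (inl c)).
have h_inj : injective h by move=> c d /(congr1 val) /= /row_of_inj [].
transitivity (\sum_(i in [set h c | c : 'I_nc]) F i)%R.
  apply: eq_bigl => i; apply/idP/imsetP => [Si|[c _ ->]]; last exact: row_special.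
  by have [c ic] := special_row (ltn_ord i) Si; exists c => //; apply: val_inj.
by rewrite big_imset //; apply: in2W.
Qed.

End Blocks.

(** * The dimension in the original Jordan basis *)

Section FullDim.
Local Open Scope nat_scope.

(** For a decreasing sequence [t_1 >= t_2 >= ...] the sum of all [minn t_i t_j] is the sum of
    [(2 i - 1) t_i], and adding the [t_i] gives [2 i t_i]. Here the sequence is
    [A 0, B 0, A 1, B 1, ...]. *)
Lemma zigzag_sum (A B : nat -> nat) n :
  (forall c d, c <= d -> A d <= A c) -> (forall c d, c <= d -> B d <= B c) ->
  (forall c, B c <= A c) -> (forall c, A c.+1 <= B c) ->
  \sum_(c < n) \sum_(d < n)
     (minn (A c) (A d) + minn (A c) (B d) + (minn (B c) (A d) + minn (B c) (B d)))
   + \sum_(c < n) (A c + B c)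
  = 2 * \sum_(c < n) ((2 * c).+1 * A c + (2 * c).+2 * B c).
Proof.
move=> A_le B_le BA AB; elim: n => [|n IHn]; first by rewrite !big_ord0.
pose G c d := minn (A c) (A d) + minn (A c) (B d) + (minn (B c) (A d) + minn (B c) (B d)).
have G1 c : c < n -> G c n = 2 * (A n + B n).
  move=> lt_c; rewrite /G; have := A_le _ _ (ltnW lt_c); have := B_le _ _ (ltnW lt_c).
  have := BA n; have := A_le _ _ lt_c; have := AB c; lia.
have G2 c : c < n -> G n c = 2 * (A n + B n).
  by move=> /G1 <-; rewrite /G; lia.
rewrite [\sum_(c < n.+1) (A c + B c)]big_ord_recr [in RHS]big_ord_recr /= mulnDr -IHn.
rewrite big_ord_recr /= -/(G n n).
under eq_bigr => c _ do rewrite big_ord_recr /= -/(G c n) G1 //.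
rewrite big_split /= sum_nat_const card_ord big_ord_recr /= -/(G n n).
under [X in _ + (X + _) + _]eq_bigr => c _ do rewrite -/(G n c) G2 //.
rewrite sum_nat_const card_ord.
have := BA n; rewrite /G; set X := \sum_(_ < _) _; set Y := \sum_(_ < _) _.
move: (A n) (B n) => a b le_ba.
rewrite !minnn (minn_idPr le_ba) (minn_idPl le_ba); nia.
Qed.

Lemma sum_rows_chain n (F : ('I_n + {h : 'I_0 & 'I_0}) + ('I_n + {h : 'I_0 & 'I_0}) -> nat) :
  \sum_p F p = \sum_(c < n) (F (inl (inl c)) + F (inr (inl c))).
Proof.
have E (H : ('I_n + {h : 'I_0 & 'I_0}) -> nat) : \sum_p H p = \sum_(c < n) H (inl c).
  by rewrite big_sumType /= [X in _ + X]big1 ?addn0 // => -[[]].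
by rewrite big_sumType /= !E -big_split.
Qed.

Lemma sumn_nth (p : seq nat) n : size p <= n -> sumn p = \sum_(i < n) nth 0 p i.
Proof.
move=> le_n; rewrite sumnE (big_nth 0) big_mkord (big_ord_widen n (fun i => nth 0 p i) le_n).
rewrite big_mkcond; apply: eq_bigr => i _; case: ltnP => // le_i.
by rewrite nth_default.
Qed.

Lemma npart_nth (p : seq nat) n : size p <= n -> npart p = \sum_(i < n) i * nth 0 p i.
Proof.
move=> le_n; rewrite /npart (big_ord_widen n (fun i => i * nth 0 p i) le_n).
rewrite big_mkcond; apply: eq_bigr => i _; case: ltnP => // le_i.
by rewrite nth_default // muln0.
Qed.

Lemma sum_shift (f : nat -> nat) n :
  \sum_(c < n) (2 * c).+2 * f c.+1 = 2 * (\sum_(c < n) c * f c) + 2 * n * f n.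
Proof.
elim: n => [|n IHn]; first by rewrite !big_ord0.
rewrite !big_ord_recr /= IHn; move: (\sum_(c < n) _) (f n) (f n.+1) => S a b.
by rewrite -addn2 -addn1; ring.
Qed.

(** With [s = 0] every row is in the chain. After the shift of the terms in [mu] at [c.+1], the
    weights are [4 c + 1] on [mu] and [4 c + 3] on [nu], which is [n + 2 b]. *)
Lemma full_dim (mu nu : seq nat) : is_partition mu -> is_partition nu ->
  chart_dim (frame_order (n := size (part_add mu nu)) (s := 0) (r := fun _ => 0)
     (nth 0 mu) (nth 0 nu) (fun _ => 0)) (fun _ _ _ => true)
  = sumn (part_add mu nu) + 2 * bstat mu nu.
Proof.
move=> mu_part nu_part; set n := size (part_add mu nu).
apply/eqP; rewrite -(eqn_pmul2l (isT : 0 < 2)) double_chart_dim //; apply/eqP.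
under eq_bigr => p _ do under eq_bigr => q _ do rewrite sum_nat_const card_ord muln1.
under [X in _ + X]eq_bigr => p _ do rewrite sum_nat_const card_ord muln1.
rewrite !sum_rows_chain /=.
under eq_bigr => c _ do rewrite !sum_rows_chain -big_split /=.
have le_mu : size mu <= n by rewrite /n size_part_add leq_maxl.
have le_nu : size nu <= n by rewrite /n size_part_add leq_maxr.
rewrite (zigzag_sum (A := fun c => nth 0 mu c + nth 0 nu c)
   (B := fun c => nth 0 nu c + nth 0 mu c.+1)); last 4 first.
- by move=> c d le_c; rewrite leq_add // partition_le.
- by move=> c d le_c; rewrite leq_add // partition_le.
- by move=> c; rewrite addnC leq_add2r partition_le.
- by move=> c; rewrite addnC leq_add2r partition_le.
congr (2 * _).
have := sum_shift (nth 0 mu) n; rewrite (nth_default _ le_mu) muln0 addn0 => Em.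
rewrite (sumn_nth (leqnn _)) -/n /bstat (sumn_nth le_nu) (npart_nth le_mu) (npart_nth le_nu).
under [X in _ = X + _]eq_bigr => i _ do rewrite nth_part_add.
transitivity (\sum_(c < n) (nth 0 mu c + nth 0 nu c) + 2 * (\sum_(c < n) nth 0 nu c)
    + 2 * (\sum_(c < n) c * nth 0 mu c) + 4 * (\sum_(c < n) c * nth 0 nu c)
    + \sum_(c < n) (2 * c).+2 * nth 0 mu c.+1); last first.
  rewrite Em -!addnA; congr (_ + _)%N; lia.
rewrite !big_distrr /= -!big_split; apply: eq_bigr => c _ /=.
by move: (nth 0 mu c.+1) (nth 0 mu c) (nth 0 nu c) => u v z; rewrite -addn2 -addn1; ring.
Qed.

End FullDim.

(** * From an orbit to its stabiliser *)

Lemma psymplectic_nondeg (k : fieldType) (W : vectType k) (omega : {skew_symmetric W}) :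
  is_psymplectic omega -> forall a, (forall b, omega a b = 0) -> a = 0.
Proof.
move=> [nd _ _] a a0; apply/eqP; rewrite -memv0 -(eqP nd).
by apply: contraT => /mem_orthovPn[v _]; rewrite a0 eqxx.
Qed.

Section Isometry.
Variables (k : fieldType) (V W : vectType k) (omega : {skew_symmetric W}).
Variable iota : 'Hom(Vsum V, W).
Hypothesis iota_isom : forall a b, omega (iota a) (iota b) = Vsum_form a b.

Lemma isometry_ker : lker iota == 0%VS.
Proof.
apply/lker0P => -[u p] [v q] eq_ab.
have E c : Vsum_form (u, p) c = Vsum_form (v, q) c by rewrite -!iota_isom eq_ab.
congr (_, _); last first.
  apply/lfunP => z; have := E (z, 0); rewrite /Vsum_form /= !zero_lfunE.
  by move/addrI/oppr_inj.
apply/eqP; rewrite -subr_eq0; apply/eqP.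
rewrite (coord_vbasis (memvf (u - v))) big1 // => i _.
have := E (0, linfun (coord (vbasis {:V}) i : V -> k^o)).
rewrite /Vsum_form /= !linear0 !lfunE /= => /addIr Eu.
by rewrite linearB /= Eu subrr scale0r.
Qed.

Lemma isometry_surj : \dim {:W} = (2 * \dim {:V})%N -> forall u, exists a, u = iota a.
Proof.
move=> dimW u; have : u \in limg iota; last by case/memv_imgP => a _ ->; exists a.
suff /eqP -> : limg iota == fullv by apply: memvf.
rewrite eqEdim subvf /= dimW.
have := limg_ker_dim iota fullv; rewrite (eqP isometry_ker) capv0 dimv0 add0n => ->.
rewrite !dimvf; have -> : dim (Vsum V) = (dim V + dim V * 1)%N by [].
by rewrite muln1 mul2n addnn.
Qed.

End Isometry.

Lemma Posz_sum (I : Type) (s : seq I) (F : I -> nat) :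
  (\sum_(i <- s) F i)%N%:Z = \sum_(i <- s) (F i)%:Z.
Proof. exact: (big_morph Posz PoszD). Qed.

Lemma levi_dim (mu nu : seq nat) :
  (\sum_h (2 * levi_rank (mu := mu) (nu := nu) h ^ 2 + levi_rank (mu := mu) (nu := nu) h))%N%:Z =
   \sum_(h < size (dparts mu nu) | Jset mu nu h)
        (2 * ((mult mu nu h)%:Z - 1) ^+ 2 + ((mult mu nu h)%:Z - 1))
   + \sum_(h < size (dparts mu nu) | ~~ Jset mu nu h)
        (2 * (mult mu nu h)%:Z ^+ 2 + (mult mu nu h)%:Z).
Proof.
rewrite Posz_sum (bigID (fun h : 'I_ _ => Jset mu nu h)) /=.
have E n : (2 * n ^ 2 + n)%N%:Z = 2 * n%:Z ^+ 2 + n%:Z.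
  by rewrite PoszD PoszM -natrXE.
congr (_ + _); apply: eq_bigr => h Jh; rewrite /levi_rank E.
  rewrite Jh; congr (_ * _ ^+ 2 + _); rewrite -(prednK (mult_gt0 (ltn_ord h))) /=; lia.
by rewrite (negPf Jh).
Qed.

Theorem theorem3p9 (k : closedFieldType) (n : nat)
    (W : vectType k) (omega : {skew_symmetric W})
    (W_symplectic : is_psymplectic omega) (dimW : \dim {:W} = (2 * n)%N)
    (V : vectType k) (dimV : \dim {:V} = n)
    (iota : 'Hom(Vsum V, W))
    (iota_isometry : forall a b, omega (iota a) (iota b) = Vsum_form a b)
    (mu nu : seq nat) (munu_bipartition : is_bipartition n mu nu)
    (w : W) (y : 'End(W)) (wy_orbit : exotic_orbit omega iota mu nu (w, y)) :
  exists (U L : 'End(W) -> Prop) (d : nat),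
    [/\ alg_semidirect_product (Sp_stab omega (w, y)) U L,
        isomorphic_alg_groups L (fun g h => (g \o h)%VF)
          (@Sp_prod k _ (@levi_rank mu nu)) (fun A B => A *m B),
        unipotent U,
        isomorphic_varieties U (@affine_space k d) &
        d%:Z = unipotent_dim n mu nu].
Proof.
have [mu_part nu_part /eqP size_n] := and3P munu_bipartition.
have nd := psymplectic_nondeg W_symplectic.
have [v [x [g [[e jb vE] Sg]]]] := wy_orbit.
rewrite /Sp_act /cone_embedding /= => -[wE yE].
pose f := (g \o iota)%VF.
(* The element [g] is absorbed into the isometry [f], so that [(w, y)] corresponds to [(v, x)]
   itself. *)
have kg := Sp_ker nd Sg; have ki := isometry_ker iota_isometry.
have f_isom a b : omega (f a) (f b) = Vsum_form a b.
  by rewrite !comp_lfunE Sg iota_isometry.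
have f_surj u : exists a, u = f a.
  have [|a ga] := isometry_surj iota_isometry _ (g^-1%VF u); first by rewrite dimW dimV.
  by exists a; rewrite comp_lfunE -ga lker0_lfunVK.
have yf a : y (f a) = f (Vsum_end x a).
  by rewrite yE !comp_lfunE !lker0_lfunK.
have {}wE : w = f (v, 0) by rewrite wE comp_lfunE.
have f_sum m (u : 'I_m -> V) : f (\sum_i u i, 0) = \sum_i f (u i, 0).
  rewrite -linear_sum; congr (f _); rewrite [RHS]surjective_pairing.
  by congr pair; rewrite raddf_sum //= big1.
have alt := pullback_alt f_isom f_surj; have adj := pullback_adj f_isom f_surj yf.
have yalt := pullback_adj_alt f_isom f_surj yf.
(* The frame of all rows only serves to compute the dimension. *)
have dim1 : has_dim (skewH omega y w) (n + 2 * bstat mu nu).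
  set l := size (part_add mu nu).
  pose R := ('I_l + {h : 'I_0 & 'I_0})%type.
  pose rho (z : R) : nat := match z with inl c => c | inr _ => 0 end.
  pose ro : R -> nat := row_ord (nth 0%N mu) (nth 0%N nu) (fun _ => 0%N).
  have rho_lt z : (rho z < l)%N by case: z => [c|[[]]] //; apply: ltn_ord.
  have rho_inj : injective rho.
    by move=> [c|[[]]] // [d|[[]]] //= E; congr inl; apply: val_inj.
  have rho_surj i : (i < l)%N -> exists z, i = rho z.
    by move=> lt_i; exists (inl (Ordinal lt_i)).
  have roE z : ro z = nth 0%N (part_add mu nu) (rho z).
    by case: z => [c|[[]]] //=; rewrite nth_part_add.
  rewrite -size_n -full_dim //.
  (* The count holds for weakly decreasing [M] and [N], so [mu] and [nu] themselves can be used, all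
     rows included. *)
  have H := (has_dim_skewH (w := w) nd adj (row_a_ord yf jb rho_lt roE) (row_b_ord yf jb roE)
    (row_aa f_isom yf jb rho_lt roE) (row_bb f_isom yf (part_add mu nu) _ _)
    (row_ab f_isom yf jb rho_lt rho_inj roE)
    (row_spanP f_surj yf jb rho_lt rho_inj rho_surj roE)).
  apply: H.
  - rewrite wE vE f_sum; apply: eq_bigr => c _.
    by rewrite (ypow_a yf jb rho_lt roE) ?roE //= nth_part_add addnK.
  - by move=> c le_c; rewrite nth_default // (leq_trans _ le_c) // /l size_part_add leq_maxl.
  - by move=> c d; apply: partition_le.
  - by move=> c d /andP[le_c _]; apply: partition_le.
have [e' jb' vE'] := jordan_absorb jb (fun i _ => nth_part_add mu nu i)
  (targetP mu_part nu_part).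
have roE := row_of_ord mu_part nu_part.
have rho_lt z : (@row_of mu nu z < size (part_add mu nu))%N by apply: row_of_lt.
have rho_inj : injective (@row_of mu nu) by apply: row_of_inj.
have rho_surj i : (i < size (part_add mu nu))%N -> exists z, i = @row_of mu nu z.
  exact: row_of_surj.
have wE' : w = \sum_(c < size (Jblocks mu nu)) ypow y (chainN mu nu c)
    (row_a f e' (@row_of mu nu) (row_ord (chainM mu nu) (chainN mu nu)
       (fun h : 'I_(size (dparts mu nu)) => nth 0%N (dparts mu nu) h)) (inl c)).
  rewrite wE vE vE' (sum_special mu_part nu_part (fun i => e' i (nth 0%N mu i))) f_sum.
  apply: eq_bigr => c _; rewrite (ypow_a yf jb' rho_lt roE) /= addnK.
  have [-> _] := row_values_of mu_part nu_part (rho_lt (inl c)).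
  by rewrite block_of_row.
have l_inj : injective (fun h : 'I_(size (dparts mu nu)) => nth 0%N (dparts mu nu) h).
  move=> h h' /eqP; rewrite nth_uniq ?undup_uniq // => /eqP; exact: val_inj.
have [U [L [d [sdp iso unip aff dimS]]]] :=
  stab_structure nd alt adj yalt (row_a_ord yf jb' rho_lt roE) (row_b_ord yf jb' roE)
    (row_aa f_isom yf jb' rho_lt roE) (row_bb f_isom yf (part_add mu nu) _ _)
    (row_ab f_isom yf jb' rho_lt rho_inj roE)
    (row_spanP f_surj yf jb' rho_lt rho_inj rho_surj roE) wE'
    (fun c le_c => (chain_out le_c).1) (@chainM_le _ _ mu_part nu_part)
    (fun c d lt_cd => chainN_le mu_part nu_part (andP lt_cd).1)
    (@chainM_lt _ _ mu_part nu_part) (@chainN_lt _ _ mu_part nu_part)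
    (fun h => dparts_gt0 mu_part nu_part (ltn_ord h)) l_inj.
exists U, L, d; split=> //.
(* One space of skew elements, measured in two frames. *)
have /(congr1 Posz) := has_dim_inj dim1 dimS.
rewrite (PoszD n) PoszM (PoszD d) levi_dim => E.
by rewrite /unipotent_dim E -addrA -opprD addrK.
Qed.
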